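(* With $Z_1$, $Z_1^S$, $\mathcal{P}$, $\mathcal{P}^S$ as defined in the context: (i) Considering any cycle, we have $$\lim_{m\to\infty}\frac{Z_1(m,m-1)}{\dim\mathcal{P}(m,m-1)}=\infty .$$ (ii) Considering only simple cycles, we have $$\lim_{m\to\infty}\frac{Z_1^S(m,m-1)}{\dim\mathcal{P}^S(m,m-1)}=\infty .$$
   Context: Let $f\in\mathbb{C}[z]$ be a polynomial of degree $m>1$ and $\Sigma\subset\mathbb{C}$ its finite set of critical values. For $t\in\mathbb{C}\setminus\Sigma$ the set $f^{-1}(t)$ consists of $m$ distinct points $z_1(t),\dots,z_m(t)$, which continue analytically to multivalued algebraic functions on $\mathbb{C}\setminus\Sigma$. A cycle of $f$ is a formal sum $C(t)=\sum_{j=1}^m n_j z_j(t)$ with $n_j\in\mathbb{Z}$ and $\sum n_j=0$; it is simple if it is of the form $z_i(t)-z_j(t)$, $i\neq j$. For $g\in\mathbb{C}[z]$, the abelian integral of $g$ along $C$ is $\int_{C(t)}g=\sum_j n_j g(z_j(t))$. Let $Z_1(f,g,C)$ be the number of isolated $t\in\mathbb{C}\setminus\Sigma$ at which at least one of the (finitely many) branches of $\int_{C(t)}g$ vanishes. Put $Z_1(m,n)=\max Z_1(f,g,C)$ over all $f$ with $\deg f\le m$, all $g$ with $\deg g\le n$ and all cycles $C$ of $f$, and let $Z_1^S(m,n)$ be the maximal number of zeros for $\deg f=m$, $\deg g=n$ and $C$ a simple cycle of $f$. For given $f$ and $C$, the space of abelian integrals is the complex vector space $\{\int_{C(t)}g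 : g\in\mathbb{C}[z],\ \deg g\le n\}$ of (germs of) algebraic functions of $t$. $\dim\mathcal{P}(m,n)$ denotes the maximum of the dimension of this space over polynomials $f$ of degree at most $m$ and all cycles $C$ of $f$, and $\dim\mathcal{P}^S(m,n)$ the maximal dimension when only polynomials $f$ of degree $m$ and their simple cycles are considered. *)

(* Defs.v *)
From HB Require Import structures.
From mathcomp Require Import all_boot all_order all_algebra.
From mathcomp Require Import complex.
From mathcomp Require Import all_classical all_reals all_analysis.

Set Implicit Arguments.
Unset Strict Implicit.
Unset Printing Implicit Defensive.

Import Order.TTheory GRing.Theory Num.Theory numFieldNormedType.Exports.

Local Open Scope classical_set_scope.
Local Open Scope ring_scope.

(* The complex numbers over R; the regular module R[i]^o carries the norm
   topology and the complex derivative. *)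
Notation Cplx R := (R[i]^o).

Section ZeroDimensionalAbelianIntegrals.
Variable R : realType.
Local Notation C := (Cplx R).
Implicit Types (f g : {poly R[i]}) (t : C).

Definition critical_values f : set C :=
  [set t | exists2 z : R[i], f^`().[z] = 0 & f.[z] = t].

(* Germs of functions are represented by total functions C -> C, compared with
   germ_eq. *)
Definition germ_eq t (F G : C -> C) : Prop := \forall u \near t, F u = G u.

Definition holomorphic_germ t (F : C -> C) : Prop :=
  \forall u \near t, derivable F u 1.

(* A germ at t of one of the algebraic functions z_j solving f(z_j(t)) = t. *)
Definition root_germ f t (z : C -> C) : Prop :=
  holomorphic_germ t z /\ \forall u \near t, f.[z u] = u.

(* A cycle is given by its germ at some noncritical base point: the germs
   z_1, ..., z_m of the m = deg f roots (pairwise distinct at the base point,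
   hence exhausting the fibre there) and the integer coefficients n_1, ..., n_m.
   The multivalued cycle C(t) consists of all its analytic continuations. *)
Record cycle f := Cycle {
  base : C;
  branch : 'I_(size f).-1 -> C -> C;
  coef : 'I_(size f).-1 -> int;
  base_regular : ~ critical_values f base;
  branch_root : forall j, root_germ f base (branch j);
  branch_inj : injective (fun j => branch j base);
  coef_sum0 : \sum_j coef j = 0 }.

Definition simple_cycle f (c : cycle f) : Prop :=
  exists i j, i != j /\
    forall k, coef c k = (k == i)%:R - (k == j)%:R.

Definition integral_along f (c : cycle f) g
    (z : 'I_(size f).-1 -> C -> C) : C -> C :=
  fun t => \sum_j (coef c j)%:~R * g.[z j t].

(* The germ at the base point of t |-> \int_{C(t)} g. *)
Definition abelian_integral f (c : cycle f) g : C -> C :=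
  integral_along c g (branch c).

(* z s is the germ at gamma s of a root of f, and these germs continue one
   another analytically along gamma : [0, 1] -> C. *)
Definition root_continuation f (gamma : R -> C) (z : R -> C -> C) : Prop :=
  {in `[0, 1], forall s,
    root_germ f (gamma s) (z s) /\
    \forall s' \near s, s' \in `[0, 1] -> germ_eq (gamma s') (z s') (z s)}.

(* F is a germ at t of a branch of the multivalued function \int_{C(t)} g: all
   the roots are continued along one and the same path avoiding the critical
   values. *)
Definition integral_branch f (c : cycle f) g t (F : C -> C) : Prop :=
  exists (gamma : R -> C) (z : 'I_(size f).-1 -> R -> C -> C),
    [/\ {within `[0, 1], continuous gamma},
        {in `[0, 1], forall s, ~ critical_values f (gamma s)},
        gamma 0 = base c /\ gamma 1 = t,
        forall j, germ_eq (base c) (z j 0) (branch c j) /\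
                  root_continuation f gamma (z j)
      & F = integral_along c g (fun j => z j 1)].

Definition integral_zeros f (c : cycle f) g : set C :=
  [set t | ~ critical_values f t /\
           exists2 F, integral_branch c g t F & F t = 0].

(* Z_1(f, g, C) is the cardinal of this set. *)
Definition isolated_zeros f (c : cycle f) g : set C :=
  isolated (integral_zeros c g).

(* The value 0 is a default, taken only when the maximum does not exist, that
   is, when the family is empty or its cardinals are not bounded by one of
   them which is finite. *)
Definition max_card (S : set (set C)) : nat :=
  xget 0%N [set k | (exists2 A, S A & (A #= `I_k)%card) /\
                    forall A, S A -> (A #<= `I_k)%card].

Definition Z1 (m n : nat) : nat :=
  max_card [set A | exists f (c : cycle f) g,
    [/\ (1 < (size f).-1 <= m)%N, (size g <= n.+1)%N
      & A = isolated_zeros c g]].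

Definition Z1S (m n : nat) : nat :=
  max_card [set A | exists f (c : cycle f) g,
    [/\ (1 < m)%N, size f = m.+1, size g = n.+1, simple_cycle c
      & A = isolated_zeros c g]].

Definition integral_space f (c : cycle f) (n : nat) : set (C -> C) :=
  [set abelian_integral c g | g in [set p : {poly R[i]} | (size p <= n.+1)%N]].

(* The germs at t of the members of V form a space with a basis of k germs. *)
Definition has_germ_dim t (V : set (C -> C)) (k : nat) : Prop :=
  exists e : 'I_k -> C -> C,
    [/\ forall i, V (e i),
        forall a : 'I_k -> R[i],
          germ_eq t (fun u => \sum_i a i * e i u) (fun=> 0) ->
          forall i, a i = 0
      & forall F, V F -> exists a : 'I_k -> R[i],
          germ_eq t F (fun u => \sum_i a i * e i u)].

(* Maximum of a set of natural numbers, with default value 0 if there is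
   none. *)
Definition max_nat (S : set nat) : nat :=
  xget 0%N [set k | S k /\ forall l, S l -> (l <= k)%N].

Definition dimP (m n : nat) : nat :=
  max_nat [set k | exists f (c : cycle f),
    (1 < (size f).-1 <= m)%N /\
    has_germ_dim (base c) (integral_space c n) k].

Definition dimPS (m n : nat) : nat :=
  max_nat [set k | exists f (c : cycle f),
    [/\ (1 < m)%N, size f = m.+1, simple_cycle c
      & has_germ_dim (base c) (integral_space c n) k]].

End ZeroDimensionalAbelianIntegrals.

(* Main.v *)
Require Import Defs.
From HB Require Import structures.
From mathcomp Require Import all_boot all_order all_algebra.
From mathcomp Require Import complex polyXY cyclic separable cyclotomic.
From mathcomp Require Import all_classical all_reals all_analysis.
From mathcomp Require Import ring lra zify.
Set Implicit Arguments.
Unset Strict Implicit.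
Unset Printing Implicit Defensive.
Import Order.TTheory GRing.Theory Num.Theory numFieldNormedType.Exports.
Local Open Scope classical_set_scope.
Local Open Scope ring_scope.

(** Both ratios grow at least linearly in m: the dimensions are at most m, while a single
    example has a number of zeros quadratic in m.

    Dimension. The integral is linear in g, so for deg g < m the space of
    integrals has dimension at most m ([germ_free_leq]); it is not zero for the
    example.

    Example. Write m = l + 2 and take f = x^m + x^2, g = x^(m-1) and a simple
    cycle. A zero t comes from a pair of distinct roots x, y of f = t with
    x^(m-1) = y^(m-1), that is y = w x with w^(m-1) = 1 and w <> 1. Put
    S(u) = 1 + u + ... + u^(m-1). The points x and u x lie in one fibre of f as
    soon as x^l S(u) = -(1 + u), and S(w) = 1, so x^l = -(1 + w) and
    t = f(x) = -w x^2. Since t^l = (-1)^l (1 + w)^2 / w, the value t determines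
    w up to w -> 1/w, and then x^2; this yields about m^2/4 values of t, critical
    for w = -1 and for at most one pair w, 1/w ([example_count]). The set of all zeros lies in a
    finite set, so each zero is isolated.

    These t are zeros of branches of one and the same integral provided that all
    pairs (x, u x) on the curve x^l S(u) = -(1 + u) are continuations of one
    another. Being reached from a given pair is a locally constant property
    ([pair_reach_near]), and the u-plane minus finitely many points is connected,
    so it is enough to reach all l points over a single u
    ([chord_reached_everywhere]). Near a simple zero rho of S, substitute
    u = rho + w^l: the function x becomes G(u) / w with G analytic and nonzero at
    rho, so that the l points over u are the values of a single function on a
    punctured w-disc, which is connected ([chord_base]). Continuation itself
    rests on a local inverse theorem for polynomials at a simple root
    ([local_inverse]), which gives deg f germs of roots near a noncritical value,
    exhausting the fibre ([local_sections]).

    Upper bound. The maxima defining Z_1 have to be shown to exist, as otherwise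
    they take their default value. For every cycle C, the monomials in the roots z_j
    with exponents less than deg f span, over C[t], a module on which multiplication
    by the integral acts by a matrix with polynomial entries, whose size and
    degrees are bounded in terms of deg f and deg g. Its characteristic polynomial
    P(t, y) vanishes at every branch y = F(t) ([annihilator]). Where a branch F
    has an isolated zero, the lowest nonzero coefficient of P in y vanishes, so
    the isolated zeros are among the roots of one polynomial of bounded degree
    ([isolated_zeros_bound]). *)

(** * Local inverses of polynomials *)

Section PolynomialContinuity.
Variable C : numFieldType.
Implicit Types (p : {poly C}).

Lemma horner_continuous p : continuous (fun x : C => p.[x] : C).
Proof.
move=> x; elim/poly_ind: p => [|p c ih].
  have -> : (fun x : C => (0 : {poly C}).[x] : C) = cst 0.
    by apply/funext => y; rewrite horner0.
  exact: cst_continuous.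
have -> : (fun x : C => (p * 'X + c%:P).[x] : C) = (fun y => p.[y] * y + c).
  by apply/funext => y; rewrite !hornerE.
have h : {for x, continuous (fun y : C => p.[y] * y)}.
  by apply: continuousM; [exact: ih|exact: cvg_id].
exact: (continuousD h (@cst_continuous _ _ c x)).
Qed.

(** The difference quotient of a polynomial extends to a continuous function of
    two variables, equal to the derivative on the diagonal. *)
Lemma horner_sub_factor p : exists H : C * C -> C,
  [/\ continuous H, forall a b : C, p.[a] - p.[b] = (a - b) * H (a, b)
    & forall a, H (a, a) = p^`().[a]].
Proof.
elim/poly_ind: p => [|p c [H [Hc HE Hd]]].
  exists (cst 0); split => [|a b|a]; first by move=> x; exact: cst_continuous.
    by rewrite !horner0 mulr0 subr0.
  by rewrite linear0 horner0.
exists (fun ab => H ab * ab.1 + p.[ab.2]); split => [ab|a b|a] /=.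
- move: ab => [u v].
  have h1 : {for (u, v), continuous (fun ab : C * C => H ab * ab.1)}.
    by apply: continuousM; [exact: Hc|exact: cvg_fst].
  have h2 : {for (u, v), continuous (fun ab : C * C => p.[ab.2])}.
    apply: (continuous_comp (f := snd) (g := fun x : C => p.[x])).
      exact: cvg_snd.
    exact: horner_continuous.
  exact: (continuousD h1 h2).
- rewrite !hornerE mulrDr mulrA -HE; ring.
- by rewrite Hd derivD derivM derivX derivC !hornerE.
Qed.

Lemma near_dist_lt (u : C) (e : C) : 0 < e -> \forall v \near u, `|u - v| < e.
Proof. by move=> e0; apply/nbhs_normP; exists e. Qed.

End PolynomialContinuity.

Section LocalInverse.
Variable C : numClosedFieldType.
Implicit Types (f p : {poly C}) (t u x : C).

Lemma prod_ge (s : seq C) (F : C -> C) (r : C) : 0 <= r ->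
  (forall z, z \in s -> r <= F z) -> r ^+ size s <= \prod_(z <- s) F z.
Proof.
move=> r0; elim: s => [|z s ih] rF; first by rewrite big_nil.
rewrite big_cons exprS ler_pM ?exprn_ge0 ?rF ?mem_head //.
by apply: ih => y ys; rewrite rF // inE ys orbT.
Qed.

(** Continuity of roots: the product of the distances from [x0] to the roots of
    [f - t] is small when [t] is close to [f.[x0]]. *)
Lemma near_root f (x0 : C) (r : C) : (1 < size f)%N -> 0 < r ->
  \forall t \near (f.[x0] : C), exists2 x : C, `|x0 - x| < r & f.[x] = t.
Proof.
move=> sf r0.
have lf : lead_coef f != 0.
  by rewrite lead_coef_eq0 -size_poly_eq0; case: (size f) sf.
pose m := (size f).-1.
have e0 : 0 < `|lead_coef f| * r ^+ m by rewrite mulr_gt0 ?normr_gt0 ?exprn_gt0.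
near=> t.
have dt : `|f.[x0] - t| < `|lead_coef f| * r ^+ m.
  by near: t; exact: near_dist_lt.
have sft : size (f - t%:P) = size f.
  by rewrite size_polyDl // size_polyN (leq_ltn_trans (size_polyC_leq1 _)).
have lft : lead_coef (f - t%:P) = lead_coef f.
  by rewrite lead_coefDl // size_polyN (leq_ltn_trans (size_polyC_leq1 _)).
have [s sE] := closed_field_poly_normal (f - t%:P).
have ss : size s = m.
  by rewrite /m -sft sE lft size_scale // size_prod_XsubC.
apply: contrapT => noroot.
have far z : z \in s -> r <= `|x0 - z|.
  move=> zs; rewrite real_leNgt ?normr_real ?gtr0_real //; apply/negP => xz.
  apply: noroot; exists z => //.
  have : root (f - t%:P) z by rewrite sE rootZ ?lft // root_prod_XsubC.
  by rewrite /root !hornerE subr_eq0 => /eqP.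
have : `|lead_coef f| * r ^+ m <= `|f.[x0] - t|.
  have -> : f.[x0] - t = (f - t%:P).[x0] by rewrite !hornerE.
  rewrite sE hornerZ lft normrM ler_pM2l ?normr_gt0 // horner_prod normr_prod.
  by rewrite -ss; apply: prod_ge (ltW r0) _ => z /far; rewrite hornerXsubC.
by move=> /(lt_le_trans dt); rewrite ltxx.
Unshelve. all: by end_near. Qed.

Lemma size_gt1_deriv f (x0 : C) : f^`().[x0] != 0 -> (1 < size f)%N.
Proof.
apply: contraNT; rewrite -leqNgt => /size1_polyC ->.
by rewrite derivC horner0.
Qed.

(** Local inverse theorem at a simple root: near [x0] the difference quotient H
    stays away from 0, so [f] is injective there and its inverse is Lipschitz;
    the derivative of the inverse is 1 / H on the diagonal. *)
Lemma local_inverse f (x0 : C) : f^`().[x0] != 0 ->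
  exists h : C -> C,
  [/\ \forall u \near f.[x0], derivable h u 1 /\ f.[h u] = u,
      h f.[x0] = x0 & \forall x \near x0, h f.[x] = x].
Proof.
move=> fx0; have sf := size_gt1_deriv fx0.
have [H [Hc HE Hd]] := horner_sub_factor f.
pose c := `|f^`().[x0]| / 2.
have c0 : 0 < c by rewrite divr_gt0 ?normr_gt0.
have [r r0 Hr] : exists2 r, 0 < r & forall a b, `|x0 - a| < r ->
    `|x0 - b| < r -> c < `|H (a, b)|.
  have : \forall ab \near (x0, x0), c < `|H ab|.
    apply: (cvgr_norm_gt _ (Hc (x0, x0))).
    by rewrite Hd /c ltr_pdivrMr // mulr_natr mulr2n ltrDl normr_gt0.
  case=> -[U V] /= [nU nV] UV.
  have /nbhs_normP[r /= r0 rUV] : nbhs x0 (U `&` V) by exact: filterI.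
  by exists r => // a b /rUV[Ua _] /rUV[_ Vb]; exact: (UV (a, b)).
have Hneq a b : `|x0 - a| < r -> `|x0 - b| < r -> H (a, b) != 0.
  by move=> ar br; rewrite -normr_gt0 (lt_trans c0 (Hr _ _ ar br)).
have finj a b : `|x0 - a| < r -> `|x0 - b| < r -> f.[a] = f.[b] -> a = b.
  move=> ar br /eqP; rewrite -subr_eq0 HE mulf_eq0 (negPf (Hneq _ _ ar br)).
  by rewrite orbF subr_eq0 => /eqP.
pose h u := xget x0 [set x | `|x0 - x| < r /\ f.[x] = u].
have hf x : `|x0 - x| < r -> h f.[x] = x.
  move=> xr; apply: xget_unique => //= y [yr fy]; exact: finj.
have hP : \forall u \near f.[x0], `|x0 - h u| < r /\ f.[h u] = u.
  near=> u; have [x xr xu] : exists2 x, `|x0 - x| < r & f.[x] = u.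
    by near: u; exact: near_root.
  by rewrite -xu hf.
exists h; split; first last.
- by near do apply: hf; exact: near_dist_lt.
- by apply: hf; rewrite subrr normr0.
near=> u.
have [hur fhu] : `|x0 - h u| < r /\ f.[h u] = u by near: u.
have nearu : \forall v \near u, `|x0 - h v| < r /\ f.[h v] = v.
  by near: u; exact: (near_join hP).
split => //.
have lip : \forall v \near u, `|h u - h v| <= `|u - v| / c.
  near=> v; have [hvr fhv] : `|x0 - h v| < r /\ f.[h v] = v by near: v.
  rewrite ler_pdivlMr // -{2}fhu -{2}fhv HE normrM ler_wpM2l //.
  exact/ltW/Hr.
have hc : h v @[v --> u] --> h u.
  apply/(@cvgrPdist_lt _ C _ (nbhs u)) => e e0; near=> v.
  apply: le_lt_trans (_ : `|u - v| / c < _); first by near: v.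
  rewrite ltr_pdivrMr //; near: v; apply: near_dist_lt.
  exact: mulr_gt0.
have Hhc : H (h v, h u) @[v --> u] --> H (h u, h u).
  apply: (cvg_comp (fun v => (h v, h u)) H _ (Hc (h u, h u))).
  exact: (cvg_pair hc (@cst_continuous _ _ (h u) u)).
have Hu : H (h u, h u) != 0 by exact: Hneq.
have shift_u : (e *: (1 : C) + u) @[e --> (0 : C)^'] --> u.
  apply/cvgrPdist_lt => e e0; near=> d.
  rewrite opprD addrCA subrr addr0 normrN /GRing.scale /= mulr1.
  near: d; apply: nbhs_dnbhs; near=> d; rewrite -normrN -[- d]add0r.
  by near: d; exact: near_dist_lt.
have Hshift : (H (h (e *: (1 : C) + u), h u))^-1 @[e --> (0 : C)^'] -->
    (H (h u, h u))^-1.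
  by apply: cvgV => //; apply: (cvg_comp _ _ shift_u Hhc).
apply: (cvgP (H (h u, h u))^-1); apply: cvg_trans Hshift.
apply: near_eq_cvg; near=> e.
have e0 : e != 0 by near: e; exact: nbhs_dnbhs_neq.
have [hvr fhv] : `|x0 - h (e *: 1 + u)| < r /\ f.[h (e *: 1 + u)] = e *: 1 + u.
  by near: e; exact: shift_u nearu.
have := HE (h (e *: 1 + u)) (h u).
rewrite fhv fhu addrK {1}/GRing.scale /= mulr1 => eE.
have Hv : H (h (e *: 1 + u), h u) != 0 by exact: Hneq.
apply: (mulfI e0); rewrite [RHS]mulVKf // [X in X / _]eE mulfK //.
Unshelve. all: by end_near. Qed.

End LocalInverse.

(** * Germs of roots *)

Section RootGerms.
Variable R : realType.
Local Notation C := (Cplx R).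
Implicit Types (f : {poly R[i]}) (t u x : C) (z w : C -> C).

(** [filterS], [filterI] and [filter_forall], with the neighbourhood filter made
    explicit for the sake of unification. *)
Lemma nearS t (P Q : C -> Prop) : (forall u, P u -> Q u) ->
  (\forall u \near t, P u) -> \forall u \near t, Q u.
Proof. exact: (@filterS C (nbhs t)). Qed.

Lemma nearI t (P Q : C -> Prop) : (\forall u \near t, P u) ->
  (\forall u \near t, Q u) -> \forall u \near t, P u /\ Q u.
Proof. exact: (@filterI C (nbhs t)). Qed.

Lemma near_all t (I : finType) (P : I -> C -> Prop) :
  (forall i, \forall u \near t, P i u) -> \forall u \near t, forall i, P i u.
Proof. exact: (@filter_forall C I P (nbhs t)). Qed.

Lemma near_comp t z (P : C -> Prop) : {for t, continuous z} ->
  (\forall v \near z t, P v) -> \forall u \near t, P (z u).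
Proof. by move=> zc nP; exact: (zc _ nP). Qed.

Lemma near_horner_neq0 t (p : {poly R[i]}) z : {for t, continuous z} ->
  p.[z t] != 0 -> \forall u \near t, p.[z u] != 0.
Proof.
move=> hz p0; exact: (hz _ (cvgr_neq0 _ (@horner_continuous R[i] p (z t)) p0)).
Qed.

Lemma noncritical_deriv f t x : ~ critical_values f t -> f.[x] = t ->
  f^`().[x] != 0.
Proof. by move=> nc fx; apply/eqP => dx; apply: nc; exists x. Qed.

Lemma local_root_germ f x : f^`().[x] != 0 -> exists h : C -> C,
  [/\ root_germ f f.[x] h, h f.[x] = x & \forall y \near x, h f.[y] = y].
Proof.
move=> /local_inverse[h [hf hx hy]]; exists h; split => //.
by split; apply: nearS hf => u [].
Qed.

Lemma root_germ_near f t z : root_germ f t z ->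
  \forall u \near t, root_germ f u z.
Proof.
move=> [hz fz]; have := nearI (near_join hz) (near_join fz).
by apply: nearS => u [].
Qed.

Lemma root_germ_root f t z : root_germ f t z -> f.[z t] = t.
Proof. by case=> _ /nbhs_singleton. Qed.

Lemma root_germ_cvg f t z : root_germ f t z -> {for t, continuous z}.
Proof.
case=> /nbhs_singleton hz _.
by apply/differentiable_continuous/derivable1_diffP.
Qed.

Lemma root_germ_unique f t z w : ~ critical_values f t ->
  root_germ f t z -> root_germ f t w -> z t = w t -> germ_eq t z w.
Proof.
move=> nc gz gw zw.
have fz := root_germ_root gz.
have [h [_ _ hy]] := local_root_germ (noncritical_deriv nc fz).
have hzc := root_germ_cvg gz hy.
have hwc : \forall y \near w t, h f.[y] = y by rewrite -zw.
have {}hwc := root_germ_cvg gw hwc.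
case: gz gw => _ gz [_ gw].
near=> u; have <- : h f.[z u] = z u by near: u.
have <- : h f.[w u] = w u by near: u.
have -> : f.[z u] = u by near: u.
by have -> : f.[w u] = u by near: u.
Unshelve. all: by end_near. Qed.

Lemma size_sub_cst f t : (1 < size f)%N -> size (f - t%:P) = size f.
Proof.
by move=> sf; rewrite size_polyDl // size_polyN (leq_ltn_trans (size_polyC_leq1 _)).
Qed.

Lemma fibre_exhaustive f t (r : 'I_(size f).-1 -> C) x : (1 < size f)%N ->
  injective r -> (forall k, f.[r k] = t) -> f.[x] = t -> exists k, r k = x.
Proof.
move=> sf ri fr fx; apply: contrapT => nx.
have sft := size_sub_cst t sf.
have : (size (x :: codom r) < size (f - t%:P)%R)%N.
  apply: max_poly_roots.
  - by rewrite -size_poly_eq0 sft; case: size sf.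
  - rewrite /= /root !hornerE fx subrr eqxx /=.
    by apply/allP => y /codomP[k ->]; rewrite /root !hornerE fr subrr.
  - rewrite /= map_inj_uniq // enum_uniq andbT.
    by apply/negP => /codomP[k xk]; apply: nx; exists k.
rewrite /= size_codom card_ord sft prednK ?ltnn //.
exact: leq_ltn_trans sf.
Qed.

Lemma noncritical_fibre f t : (1 < size f)%N -> ~ critical_values f t ->
  exists2 r : 'I_(size f).-1 -> C, injective r & forall k, f.[r k] = t.
Proof.
move=> sf nc; have sft := size_sub_cst t sf.
have f0 : f - t%:P != 0 by rewrite -size_poly_eq0 sft; case: size sf.
have [s sE] := closed_field_poly_normal (f - t%:P).
have lc : lead_coef (f - t%:P) != 0 by rewrite lead_coef_eq0.
have ss : size s = (size f).-1.
  by rewrite -sft sE size_scale // size_prod_XsubC.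
have us : uniq s.
  rewrite -(@separable_prod_XsubC R[i]) -(eqp_separable (eqp_scale _ lc)) -sE.
  rewrite separable_poly.unlock; apply: Pdiv.ClosedField.root_coprimep => x.
  rewrite rootE !hornerE subr_eq0 derivB derivC subr0 => /eqP.
  exact: noncritical_deriv.
exists (fun k => s`_k) => [k l /eqP|k].
  by rewrite nth_uniq ?ss // => /eqP; exact: val_inj.
have : root (f - t%:P) s`_k.
  by rewrite sE rootZ // root_prod_XsubC mem_nth // ss.
by rewrite rootE !hornerE subr_eq0 => /eqP.
Qed.

(** Near a noncritical value [t] the roots of [f - u] are [deg f] holomorphic
    functions of [u] with distinct values, each one a local inverse of [f]. *)
Lemma local_sections f t : (1 < size f)%N -> ~ critical_values f t ->
  exists h : 'I_(size f).-1 -> C -> C,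
  (\forall u \near t, [/\ ~ critical_values f u,
     forall k, root_germ f u (h k) & injective (fun k => h k u)]) /\
  forall k, \forall x \near h k t, h k f.[x] = x.
Proof.
move=> sf nc; have [r ri fr] := noncritical_fibre sf nc.
have /choice[h hP] : forall k, exists h : C -> C,
  [/\ root_germ f t h, h t = r k & \forall y \near r k, h f.[y] = y].
  move=> k; rewrite -(fr k); apply: local_root_germ.
  exact: noncritical_deriv nc (fr k).
exists h; split; last by move=> k; case: (hP k) => _ -> .
have near_inj : \forall u \near t, forall kl : 'I_(size f).-1 * 'I_(size f).-1,
    kl.1 != kl.2 -> h kl.1 u - h kl.2 u != 0.
  apply: near_all => -[k l] /=.
  have [-> | kl] := eqVneq k l; first by near=> u.
  have [gk hk _] := hP k; have [gl hl _] := hP l.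
  have hkl := continuousB (root_germ_cvg gk) (root_germ_cvg gl).
  have : \forall u \near t, h k u - h l u != 0.
    apply: (cvgr_neq0 _ hkl).
    change (h k t - h l t != 0); rewrite hk hl subr_eq0.
    by apply/eqP => /ri klE; rewrite klE eqxx in kl.
  by apply: nearS.
have near_germ : \forall u \near t, forall k, root_germ f u (h k).
  by apply: near_all => k; apply: root_germ_near; case: (hP k).
have near_der : \forall u \near t, forall k, f^`().[h k u] != 0.
  apply: near_all => k; have [gk hk _] := hP k.
  apply: near_horner_neq0; first exact: root_germ_cvg gk.
  by apply: noncritical_deriv nc _; exact: root_germ_root.
near=> u.
have hu : forall kl : 'I_(size f).-1 * 'I_(size f).-1,
    kl.1 != kl.2 -> h kl.1 u - h kl.2 u != 0 by near: u.
have hi : injective (fun k => h k u).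
  move=> k l /= /eqP; rewrite -subr_eq0; apply: contraTeq => kl.
  exact: (hu (k, l) kl).
have hg : forall k, root_germ f u (h k) by near: u.
split=> // -[x dx fx].
have [k kx] := fibre_exhaustive sf hi (fun k => root_germ_root (hg k)) fx.
have : f^`().[h k u] != 0 by move: k {kx}; near: u.
by rewrite kx dx eqxx.
Unshelve. all: by end_near. Qed.
End RootGerms.

(** * Continuation along paths *)

Section Continuation.
Variable R : realType.
Local Notation C := (Cplx R).
Implicit Types (f : {poly R[i]}) (t u x : C) (z w : C -> C) (s : R).

(** Connectedness of the unit interval, for properties. *)
Lemma locally_constant01 (P : R -> Prop) :
  {in `[0, 1], forall s, \forall s' \near s, s' \in `[0, 1] -> (P s' <-> P s)} ->
  P 0 -> P 1.
Proof.
move=> lc P0.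
have BE : `[0, 1]%classic `&` P = `[0, 1]%classic :> set R.
  apply: (@segment_connected R 0 1).
  - by exists 0; split => //=; rewrite in_itv /= lexx ler01.
  - exists [set s | s \in `[0, 1] -> P s]°; first exact: open_interior.
    apply/seteqP; split => s [s01 Ps]; split => //.
      by have := lc _ s01; apply: filterS => s' h /= /h [_]; apply.
    exact: (interior_subset Ps).
  - exists (~` [set s | s \in `[0, 1] -> ~ P s]°).
      exact/open_closedC/open_interior.
    apply/seteqP; split => s [s01 Ps]; split => //.
      by move=> /interior_subset /(_ s01).
    apply: contrapT => nP; apply: Ps.
    by have := lc _ s01; apply: filterS => s' h /= /h [hP _] /hP.
have : (`[0, 1]%classic `&` P) 1 by rewrite BE /= in_itv /= ler01 lexx.
by case.
Qed.

Lemma within01P (gamma : R -> C) : {within `[0, 1], continuous gamma} <->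
  {in `[0, 1], forall s, forall P : set C, nbhs (gamma s) P ->
     \forall s' \near s, s' \in `[0, 1] -> P (gamma s')}.
Proof.
rewrite subspace_continuousP; split=> [h s s01 P nP|h s s01 P nP].
  exact: (h s s01 P nP).
exact: (h s s01 P nP).
Qed.

Lemma real_complex_continuous : continuous (fun s => s%:C : C)%C.
Proof.
move=> s; apply/(@cvgrPdist_lt _ C _ (nbhs s)) => e e0.
have eE : e = ((complex.Re e)%:C)%C by rewrite RRe_real // gtr0_real.
near=> s'; rewrite -rmorphB /= normc_def /= expr0n addr0 sqrtr_sqr eE ltcR.
near: s'; apply: near_dist_lt.
by rewrite -ltcR -eE.
Unshelve. all: by end_near. Qed.

(** The segment from [t] to [u], parametrized by the unit interval. *)
Definition segment_path t u s : C := t + (s%:C)%C * (u - t).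

Lemma segment_path_continuous t u : continuous (segment_path t u).
Proof.
move=> s; rewrite /segment_path.
have h : {for s, continuous (fun s => (s%:C)%C * (u - t) : C)}.
  apply: (@continuousM R[i] R (fun s => (s%:C)%C) (cst (u - t))).
    exact: real_complex_continuous.
  exact: cst_continuous.
exact: (@continuousD _ _ _ (cst t) _ s (@cst_continuous _ _ t s) h).
Qed.

(** The germs [z' j] at [t'] are obtained from the germs [z j] at [t] by analytic
    continuation as roots of [f - t], all along one path avoiding the critical
    values. *)
Definition continues f (I : Type) t (z : I -> C -> C) t' (z' : I -> C -> C) :=
  exists (gamma : R -> C) (Z : I -> R -> C -> C),
    [/\ {within `[0, 1], continuous gamma},
        {in `[0, 1], forall s, ~ critical_values f (gamma s)},
        gamma 0 = t /\ gamma 1 = t',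
        forall j, germ_eq t (Z j 0) (z j) /\ root_continuation f gamma (Z j)
      & z' = fun j => Z j 1].

Lemma germ_eq_refl t z : germ_eq t z z.
Proof. by rewrite /germ_eq; near=> u. Unshelve. all: by end_near. Qed.

Lemma germ_eq_sym t z w : germ_eq t z w -> germ_eq t w z.
Proof. exact: nearS. Qed.

Lemma germ_eq_trans t z w v : germ_eq t z w -> germ_eq t w v -> germ_eq t z v.
Proof. by move=> h1 h2; apply: nearS (nearI h1 h2) => u [-> ->]. Qed.

Lemma germ_eq_near t z w : germ_eq t z w -> \forall u \near t, germ_eq u z w.
Proof. exact: near_join. Qed.

Lemma zero_in01 : (0 : R) \in `[0, 1]. Proof. by rewrite in_itv /= lexx ler01. Qed.
Lemma one_in01 : (1 : R) \in `[0, 1]. Proof. by rewrite in_itv /= lexx ler01. Qed.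
Hint Resolve zero_in01 one_in01 : core.

Lemma segment_path0 t u : segment_path t u 0 = t.
Proof. by rewrite /segment_path rmorph0 mul0r addr0. Qed.

Lemma segment_path1 t u : segment_path t u 1 = u.
Proof. by rewrite /segment_path rmorph1 mul1r addrCA subrr addr0. Qed.

Lemma continues_segment f I t u (z : I -> C -> C) :
  {in `[0, 1], forall s, ~ critical_values f (segment_path t u s) /\
    forall j, root_germ f (segment_path t u s) (z j)} ->
  continues f t z u z.
Proof.
move=> h; exists (segment_path t u), (fun j _ => z j); split => //.
- exact/continuous_subspaceT/segment_path_continuous.
- by move=> s /h[].
- by rewrite segment_path0 segment_path1.
- move=> j; split; first exact: germ_eq_refl.
  move=> s s01; split; first by case: (h s s01).
  by near=> s' => _; exact: germ_eq_refl.
Unshelve. all: by end_near. Qed.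

Lemma segment_path_ball (c : C) (r : R[i]) t u s : s \in `[0, 1] ->
  `|c - t| < r -> `|c - u| < r -> `|c - segment_path t u s| < r.
Proof.
rewrite in_itv /= => /andP[s0 s1] ct cu.
have -> : c - segment_path t u s =
    (1 - (s%:C)%C) * (c - t) + (s%:C)%C * (c - u).
  by rewrite /segment_path; ring.
have s0' : 0 <= (s%:C)%C :> R[i] by rewrite ler0c.
have s1' : 0 <= 1 - (s%:C)%C :> R[i].
  by rewrite -(rmorph1 (real_complex R)) subr_ge0 lecR.
apply: le_lt_trans (ler_normD _ _) _; rewrite !normrM (ger0_norm s0') (ger0_norm s1').
have [->|s_neq0] := eqVneq s 0.
  by rewrite rmorph0 mul0r addr0 subr0 mul1r.
have sp : 0 < (s%:C)%C :> R[i].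
  by rewrite lt0r s0' andbT -(rmorph0 (real_complex R)) (inj_eq (@complexI _)).
apply: (@lt_le_trans _ _ ((1 - (s%:C)%C) * r + (s%:C)%C * r)).
  by apply: ler_ltD; [apply: ler_wpM2l => //; exact: ltW|rewrite ltr_pM2l].
by rewrite -mulrDl subrK mul1r.
Qed.

Lemma near_norm_ball t (P : C -> Prop) : (\forall u \near t, P u) ->
  exists2 r : R[i], 0 < r & forall u, `|t - u| < r -> P u.
Proof. by move=> /nbhs_normP[r /= r0 rP]; exists r => // u /rP. Qed.

(** Germs defined on a disc continue themselves along any segment in the disc. *)
Lemma continues_near f (I : finType) t (z : I -> C -> C) :
  (\forall u \near t, ~ critical_values f u /\ forall j, root_germ f u (z j)) ->
  exists2 r : R[i], 0 < r & forall t1 t2, `|t - t1| < r -> `|t - t2| < r ->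
    continues f t1 z t2 z.
Proof.
move=> /near_norm_ball[r r0 rP]; exists r => // t1 t2 rt1 rt2.
by apply: continues_segment => s s01; apply: rP; exact: segment_path_ball.
Qed.

Lemma continues_end f I t (z : I -> C -> C) t' (z' : I -> C -> C) :
  continues f t z t' z' ->
  ~ critical_values f t' /\ forall j, root_germ f t' (z' j).
Proof.
move=> [g [Z [_ nc [_ <-] h ->]]]; split; first exact: nc.
by move=> j; have [_ /(_ 1 one_in01)[]] := h j.
Qed.

(** Distinct roots stay distinct along a path. *)
Lemma continues_inj f I t (z : I -> C -> C) t' (z' : I -> C -> C) i j :
  continues f t z t' z' ->
  z i t != z j t -> z' i t' != z' j t'.
Proof.
move=> [g [Z [gc nc [<- <-] h ->]]].
have [hi0 hi] := h i; have [hj0 hj] := h j.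
rewrite -(nbhs_singleton hi0) -(nbhs_singleton hj0).
move=> z0; pose P s := Z i s (g s) != Z j s (g s).
suff : P 1 by [].
apply: (@locally_constant01 P _ z0) => s s01.
have [gi ni] := hi s s01; have [gj nj] := hj s s01.
have near_eq : \forall u \near g s, (Z i s u != Z j s u) = (Z i s (g s) != Z j s (g s)).
  have [e|e] := eqVneq (Z i s (g s)) (Z j s (g s)).
    apply: nearS (root_germ_unique (nc s s01) gi gj e) => u ->.
    by rewrite eqxx.
  have hB := continuousB (root_germ_cvg gi) (root_germ_cvg gj).
  have : \forall u \near g s, Z i s u - Z j s u != 0.
    apply: (cvgr_neq0 _ hB).
    by change (Z i s (g s) - Z j s (g s) != 0); rewrite subr_eq0.
  by apply: nearS => u; rewrite subr_eq0 => ->.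
have near_eq' := (iffLR (within01P g) gc) s s01 _ near_eq.
near=> s' => s'01; rewrite /P.
have e : (Z i s (g s') != Z j s (g s')) = (Z i s (g s) != Z j s (g s)).
  by move: s'01; near: s'.
have ei : germ_eq (g s') (Z i s') (Z i s) by move: s'01; near: s'.
have ej : germ_eq (g s') (Z j s') (Z j s) by move: s'01; near: s'.
by rewrite (nbhs_singleton ei) (nbhs_singleton ej) e.
Unshelve. all: by end_near. Qed.

Lemma near_comp_affine (a b s : R) (P : R -> Prop) :
  (\forall x \near a * s + b, P x) -> \forall x \near s, P (a * x + b).
Proof.
move=> h.
have hc : {for s, continuous (fun x : R => a * x + b)}.
  have h1 : {for s, continuous (fun x : R => a * x)}.
    by apply: continuousM; [exact: cst_continuous|exact: cvg_id].
  exact: (continuousD h1 (@cst_continuous _ _ b s)).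
exact: (hc _ h).
Qed.

(** Neighbourhoods of a point in the union of the half-lines bounded by 1/2. *)
Lemma near_split_half (s : R) (Q : R -> Prop) :
  (s <= 1/2 -> \forall s' \near s, s' <= 1/2 -> Q s') ->
  (1/2 <= s -> \forall s' \near s, 1/2 <= s' -> Q s') ->
  \forall s' \near s, Q s'.
Proof.
move=> h1 h2; have [s2|s2|s2] := ltgtP s (1/2).
- have {}h1 := h1 (ltW s2); near=> s'.
  have : `|s - s'| < 1/2 - s by near: s'; apply: near_dist_lt; lra.
  by rewrite ltr_norml => /andP[? ?]; have : s' <= 1/2 by [lra]; near: s'.
- have {}h2 := h2 (ltW s2); near=> s'.
  have : `|s - s'| < s - 1/2 by near: s'; apply: near_dist_lt; lra.
  by rewrite ltr_norml => /andP[? ?]; have : 1/2 <= s' by [lra]; near: s'.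
- have {}h1 : \forall s' \near s, s' <= 1/2 -> Q s' by apply: h1; lra.
  have {}h2 : \forall s' \near s, 1/2 <= s' -> Q s' by apply: h2; lra.
  near=> s'; have [s'2|/ltW s'2] := leP s' (1/2); first by move: s'2; near: s'.
  by move: s'2; near: s'.
Unshelve. all: by end_near. Qed.

(** Concatenation of paths. *)
Lemma continues_trans f I t (z : I -> C -> C) t' (z' w : I -> C -> C) t''
    (w'' : I -> C -> C) : continues f t z t' z' ->
  (forall j, germ_eq t' (z' j) (w j)) ->
  continues f t' w t'' w'' -> continues f t z t'' w''.
Proof.
move=> [g1 [Z1 [/within01P c1 nc1 [g10 g11] h1 z'E]]] zw.
move=> [g2 [Z2 [/within01P c2 nc2 [g20 g21] h2 w''E]]].
pose g (s : R) := if s <= 1/2 then g1 (2 * s + 0) else g2 (2 * s + (-1)).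
pose Z j (s : R) := if s <= 1/2 then Z1 j (2 * s + 0) else Z2 j (2 * s + (-1)).
have in1 (s : R) : s \in `[0, 1] -> s <= 1/2 -> 2 * s + 0 \in `[0, 1].
  by rewrite !in_itv /= => /andP[? ?] ?; apply/andP; split; lra.
have in2 (s : R) : s \in `[0, 1] -> 1/2 <= s -> 2 * s + (-1) \in `[0, 1].
  by rewrite !in_itv /= => /andP[? ?] ?; apply/andP; split; lra.
have gluing j : germ_eq t' (Z2 j 0) (Z1 j 1).
  apply: germ_eq_trans (h2 j).1 _; apply: germ_eq_sym.
  by have := zw j; rewrite z'E.
have gE1 (s : R) : s <= 1/2 -> g s = g1 (2 * s + 0) by rewrite /g => ->.
have gE2 (s : R) : 1/2 <= s -> g s = g2 (2 * s + (-1)).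
  rewrite le_eqVlt => /orP[/eqP <-|s1]; last by rewrite /g leNgt s1.
  rewrite gE1 // (_ : 2 * (1/2) + 0 = 1) ?g11; last by field.
  by rewrite (_ : 2 * (1/2) + (-1) = 0) ?g20 //; field.
have ZE1 j (s : R) : s <= 1/2 -> Z j s = Z1 j (2 * s + 0) by rewrite /Z => ->.
have ZE2 j (s : R) : 1/2 <= s -> germ_eq (g s) (Z j s) (Z2 j (2 * s + (-1))).
  rewrite le_eqVlt => /orP[/eqP <-|s1]; last first.
    by rewrite /Z leNgt s1; exact: germ_eq_refl.
  rewrite gE1 // ZE1 // (_ : 2 * (1/2) + 0 = 1) ?g11; last by field.
  rewrite (_ : 2 * (1/2) + (-1) = 0); last by field.
  exact/germ_eq_sym/gluing.
have gc : {in `[0, 1], forall s, forall P : set C, nbhs (g s) P ->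
    \forall s' \near s, s' \in `[0, 1] -> P (g s')}.
  move=> s s01 P nP; apply: near_split_half => s2.
    move: nP; rewrite gE1 // => /(c1 _ (in1 s s01 s2)) /near_comp_affine.
    apply: filterS => s' h s'2 s'01; rewrite gE1 //; apply: h; exact: in1.
  move: nP; rewrite gE2 // => /(c2 _ (in2 s s01 s2)) /near_comp_affine.
  apply: filterS => s' h s'2 s'01; rewrite gE2 //; apply: h; exact: in2.
exists g, Z; split.
- exact/within01P.
- move=> s s01; have [s2|/ltW s2] := leP s (1/2).
    by rewrite gE1 //; apply: nc1; exact: in1.
  by rewrite gE2 //; apply: nc2; exact: in2.
- rewrite gE1 ?gE2; [|lra|lra].
  by rewrite mulr0 addr0 g10 (_ : 2 * 1 + (-1) = 1 :> R) //; ring.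
- move=> j; split.
    by rewrite ZE1; [rewrite mulr0 addr0; exact: (h1 j).1|lra].
  move=> s s01; split.
    have [s2|s2] := leP s (1/2).
      by rewrite gE1 // ZE1 //; exact: ((h1 j).2 _ (in1 s s01 s2)).1.
    have s2' := ltW s2.
    rewrite gE2 // /Z leNgt s2 /=; exact: ((h2 j).2 _ (in2 s s01 s2')).1.
  apply: near_split_half => s2.
    have /near_comp_affine := ((h1 j).2 _ (in1 s s01 s2)).2.
    apply: filterS => s' h s'2 s'01.
    by rewrite gE1 // !ZE1 //; apply: h; exact: in1.
  have /near_comp_affine n1 := ((h2 j).2 _ (in2 s s01 s2)).2.
  have n2 := gc s s01 _ (germ_eq_near (ZE2 j s s2)).
  near=> s' => s'2 s'01.
  apply: germ_eq_trans (ZE2 j s' s'2) _.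
  apply: (@germ_eq_trans _ _ (Z2 j (2 * s + (-1)))).
    by rewrite gE2 //; have := in2 s' s'01 s'2; near: s'.
  by apply: germ_eq_sym; move: s'01; near: s'.
- rewrite w''E; apply/funext => j; rewrite /Z ifF.
    by rewrite (_ : 2 * 1 + (-1) = 1 :> R) //; ring.
  by apply/negbTE; rewrite -ltNge; lra.
Unshelve. all: by end_near. Qed.
End Continuation.

(** * Locally constant properties and reachable pairs of roots *)

Section Connectivity.
Variable R : realType.
Local Notation C := (Cplx R).
Implicit Types (f : {poly R[i]}) (t u x y : C).

Lemma locally_constant_segment (P : C -> Prop) a b :
  {in `[0, 1], forall s, \forall v \near segment_path a b s,
     P v <-> P (segment_path a b s)} -> P a <-> P b.
Proof.
have aux (Q : C -> Prop) : {in `[0, 1], forall s,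
    \forall v \near segment_path a b s, Q v <-> Q (segment_path a b s)} ->
    Q a -> Q b.
  move=> lc; rewrite -[in Q a](segment_path0 a b) -[in Q b](segment_path1 a b).
  apply: (@locally_constant01 R (fun s => Q (segment_path a b s))) => s s01.
  apply: (@filterS R (nbhs s) _ _ _ _ (segment_path_continuous (lc s s01))).
  by move=> s' h _; exact: h.
move=> lc; split; first exact: aux.
move=> Pb; apply: contrapT => nPa.
apply: (aux (fun v => ~ P v)) nPa Pb => s /lc.
by apply: nearS => v h; rewrite h.
Qed.

Lemma near_right_notin (L : seq R) : \forall e \near 0^'+, e \notin L.
Proof.
elim: L => [|q L ih]; first by near=> e.
have hq : \forall e \near 0^'+, e != q.
  have [q0|q0] := leP q 0.
    near=> e; have e0 : 0 < e by near: e; exact: nbhs_right_gt.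
    by rewrite gt_eqF // (le_lt_trans q0 e0).
  near=> e; apply/negbT/lt_eqF; near: e; exact: nbhs_right_lt.
by near=> e; rewrite inE negb_or; apply/andP; split; near: e.
Unshelve. all: by end_near. Qed.

(** For fixed nonzero real part [c], a point [q] lies on the segment from [a] to
    [a + d * (c + i e)] for at most one value of [e]. *)
Lemma segment_avoid (a d q : C) (c e : R) s : c != 0 -> d != 0 -> q != a ->
  e != c * complex.Im ((q - a) / d) / complex.Re ((q - a) / d) ->
  segment_path a (a + d * Complex c e) s != q.
Proof.
move=> c0 d0 qa ne; apply/eqP => sq; case/eqP: ne.
have -> : (q - a) / d = Complex (s * c) (s * e).
  rewrite -sq /segment_path !(addrAC _ _ (- a)) subrr !add0r.
  rewrite mulrCA mulrAC divff // mul1r.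
  by apply/eqP; rewrite eq_complex /= !mul0r subr0 addr0 !eqxx.
have s0 : s != 0.
  by apply: contra_neq qa => s0; rewrite -sq s0 segment_path0.
by rewrite /=; field; rewrite s0 c0.
Qed.

(** A disc minus finitely many points is connected: two of its points are joined
    by a broken line through a point of their perpendicular bisector, and all but
    finitely many such lines avoid the removed points. *)
Lemma locally_constant_disc (c : C) (r : R[i]) (F : seq C) (P : C -> Prop) a b :
  (forall v, `|c - v| < r -> v \notin F -> \forall u \near v, P u <-> P v) ->
  `|c - a| < r -> `|c - b| < r -> a \notin F -> b \notin F -> P a <-> P b.
Proof.
move=> lc ca cb aF bF; have [->//|ab] := eqVneq a b.
have d0 : b - a != 0 by rewrite subr_eq0 eq_sym.
pose bad a d c := [seq c * complex.Im ((q - a) / d) / complex.Re ((q - a) / d) | q <- F].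
pose p (e : R) : C := a + (b - a) * Complex (1/2) e.
have pb e : p e = b + (b - a) * Complex (- (1/2)) e.
  rewrite /p; have -> : Complex (- (1/2)) e = Complex (1/2) e - 1 :> R[i].
    by apply/eqP; rewrite eq_complex /= !subr0 eqxx andbT; apply/eqP; field.
  by rewrite mulrBr mulr1 addrA opprB addrCA; ring.
have [e [ce e1 e2]] : exists e, [/\ `|c - p e| < r,
    e \notin bad a (b - a) (1/2) & e \notin bad b (b - a) (- (1/2))].
  pose m := segment_path a b (1/2).
  have pm e : p e = segment_path m (m + (b - a) * Complex 0 1) e.
    rewrite /p /m /segment_path.
    have -> : Complex (1/2) e = ((1/2)%:C)%C + (e%:C)%C * Complex 0 1 :> R[i].
      apply/eqP; rewrite eq_complex /=; apply/andP; split; apply/eqP; ring.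
    ring.
  have cm : `|c - m| < r.
    by apply: segment_path_ball => //; rewrite in_itv /=; apply/andP; split; lra.
  have near_m : \forall v \near m, `|c - v| < r.
    near=> v; have -> : c - v = (c - m) + (m - v) by ring.
    apply: le_lt_trans (ler_normD _ _) _; rewrite -ltrBrDl.
    by near: v; apply: near_dist_lt; rewrite subr_gt0.
  have pr : \forall e \near (0 : R)^'+, `|c - p e| < r.
    apply: cvg_within.
    have := @segment_path_continuous R m (m + (b - a) * Complex 0 1) 0.
    rewrite /continuous_at segment_path0 => /(_ _ near_m).
    by apply: (@filterS R (nbhs (0 : R))) => e; rewrite pm.
  (* [m] is the midpoint of the segment and [p e] is on its bisector. *)
  near (0 : R)^'+ => e; exists e; split; near: e => //; exact: near_right_notin.
have side a' c' : c' != 0 -> `|c - a'| < r -> a' \notin F ->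
    p e = a' + (b - a) * Complex c' e -> e \notin bad a' (b - a) c' ->
    P a' <-> P (p e).
  move=> c'0 ca' a'F pE e'; apply: locally_constant_segment => s s01; apply: lc.
    exact: segment_path_ball.
  apply/negP => qF; move/mapP: e'; apply.
  exists (segment_path a' (p e) s) => //; apply/eqP.
  have qa : segment_path a' (p e) s != a'.
    by apply: contraTneq qF => ->.
  rewrite pE in qa *; apply: contraT => /(segment_avoid s c'0 d0 qa).
  by rewrite eqxx.
rewrite (side a (1/2)) // -?(side b (- (1/2))) //; by lra.
Unshelve. all: by end_near. Qed.

Lemma locally_constant_plane (F : seq C) (P : C -> Prop) a b :
  (forall v, v \notin F -> \forall u \near v, P u <-> P v) ->
  a \notin F -> b \notin F -> P a <-> P b.
Proof.
move=> lc; apply: (@locally_constant_disc 0 (`|a| + `|b| + 1)).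
- by move=> v _; exact: lc.
- by rewrite sub0r normrN -addrA ltrDl ltr_wpDl.
- by rewrite sub0r normrN addrAC ltrDr ltr_wpDl.
Qed.
End Connectivity.

Section PairReachability.
Variable R : realType.
Local Notation C := (Cplx R).
Variable f : {poly R[i]}.
Hypothesis sf : (1 < size f)%N.
Variables (t0 : C) (z0 : 'I_(size f).-1 -> C -> C) (i j : 'I_(size f).-1).

(** The pair of roots numbered [i] and [j] of the cycle with germs [z0] at [t0]
    can be continued to the pair [(x, y)] of roots over [f.[x]]. *)
Definition pair_reach (x y : C) :=
  exists zs, [/\ continues f t0 z0 f.[x] zs, zs i f.[x] = x & zs j f.[x] = y].

(** A continuation that ends at [t] can be prolonged along a segment on which the
    sections [h] exhaust the fibres of [f]: the germs at the end are sections. *)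
Lemma continues_relabel t u (zs h : 'I_(size f).-1 -> C -> C) :
  continues f t0 z0 t zs ->
  {in `[0, 1], forall s, ~ critical_values f (segment_path t u s) /\
    forall k, root_germ f (segment_path t u s) (h k)} ->
  injective (fun k => h k t) ->
  exists p : 'I_(size f).-1 -> 'I_(size f).-1,
    continues f t0 z0 u (fun k => h (p k)) /\ forall k, h (p k) t = zs k t.
Proof.
move=> c0 hh hi.
have [nc rz] := continues_end c0.
have rh k : root_germ f t (h k).
  by have [_ /(_ k)] := hh 0 (zero_in01 _); rewrite segment_path0.
have /choice[p pE] : forall k, exists l, h l t = zs k t.
  move=> k; apply: (fibre_exhaustive (r := fun l => h l t) sf hi).
    by move=> l; exact: root_germ_root (rh l).
  exact: root_germ_root (rz k).
exists p; split => //.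
apply: (continues_trans (w := fun k => h (p k)) c0).
  by move=> k; apply: (root_germ_unique nc (rz k) (rh (p k))); rewrite pE.
by apply: continues_segment => s s01; have [? ?] := hh s s01; split => // k.
Qed.

Lemma pair_reach_local (x0 y0 : C) : ~ critical_values f f.[x0] ->
  f.[y0] = f.[x0] -> exists U V : set C, [/\ nbhs x0 U, nbhs y0 V &
    forall x y x' y', U x -> U x' -> V y -> V y' -> f.[x] = f.[y] ->
      f.[x'] = f.[y'] -> pair_reach x y -> pair_reach x' y'].
Proof.
move=> nc fy; have [h [hn hk]] := local_sections sf nc.
have /near_norm_ball[r r0 hr] := hn.
have h0 : forall l, root_germ f f.[x0] (h l).
  by have [] := hr f.[x0]; rewrite ?subrr ?normr0.
have hi : injective (fun l => h l f.[x0]).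
  by have [] := hr f.[x0]; rewrite ?subrr ?normr0.
have [k kx] := fibre_exhaustive sf hi (fun l => root_germ_root (h0 l)) erefl.
have [l ly] := fibre_exhaustive sf hi (fun l => root_germ_root (h0 l)) fy.
exists [set x | h k f.[x] = x /\ `|f.[x0] - f.[x]| < r].
exists [set x | h l f.[x] = x /\ `|f.[x0] - f.[x]| < r].
have nb (x1 : C) : f.[x1] = f.[x0] -> \forall x \near x1, `|f.[x0] - f.[x]| < r.
  move=> <-; exact: (@horner_continuous R[i] f x1 _ (near_dist_lt _ r0)).
split.
- by apply: nearI; [rewrite -{1}kx; exact: hk|exact: nb].
- by apply: nearI; [rewrite -{1}ly; exact: hk|exact: nb].
move=> x y x' y' [hx xr] [hx' xr'] [hy yr] [hy' yr'] fxy fxy' [zs [c0 zi zj]].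
have hs : {in `[0, 1], forall s, ~ critical_values f (segment_path f.[x] f.[x'] s) /\
    forall k, root_germ f (segment_path f.[x] f.[x'] s) (h k)}.
  move=> s s01; have [] := hr (segment_path f.[x] f.[x'] s) => //.
  exact: segment_path_ball.
have hix : injective (fun k => h k f.[x]) by have [] := hr f.[x].
have [p [cp pE]] := continues_relabel c0 hs hix.
exists (fun k => h (p k)); split => //.
  have -> : p i = k by apply: hix; rewrite /= pE zi hx.
  exact: hx'.
have -> : p j = l by apply: hix; rewrite /= pE zj -{1}hy fxy.
by rewrite fxy'.
Qed.

(** Reachability is locally constant along a continuous family of pairs of points
    with the same image under [f]. *)
Lemma pair_reach_near (X Y : C -> C) (v : C) :
  ~ critical_values f f.[X v] -> {for v, continuous X} -> {for v, continuous Y} ->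
  (\forall u \near v, f.[Y u] = f.[X u]) ->
  \forall u \near v, pair_reach (X u) (Y u) <-> pair_reach (X v) (Y v).
Proof.
move=> nc Xc Yc fXY; have fv := nbhs_singleton fXY.
have [U [V [nU nV UV]]] := pair_reach_local nc fv.
have := nearI fXY (nearI (Xc _ nU) (Yc _ nV)).
apply: nearS => u [fu [Uu Vu]].
have Uv := nbhs_singleton nU; have Vv := nbhs_singleton nV.
by split; apply: UV.
Qed.
End PairReachability.

(** * The trinomial x^(l+2) + x^2 and its chord curve *)

Section ClosedFieldRoots.
Variable K : numClosedFieldType.
Implicit Types (p : {poly K}) (x : K).

Lemma prim_root_exists n : (0 < n)%N -> exists z : K, n.-primitive_root z.
Proof.
move=> n_gt0; pose p : {poly K} := 'X^n - 1.
have [r pE] := closed_field_poly_normal p.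
have mp : lead_coef p = 1 by apply/eqP; exact: monicXnsubC.
rewrite mp scale1r in pE.
have sr : size r = n.
  by have := size_XnsubC (1 : K) n_gt0; rewrite -/p pE size_prod_XsubC => -[].
have ur : uniq r.
  rewrite -separable_prod_XsubC -pE; apply: separable_Xn_sub_1.
  by rewrite pnatr_eq0 -lt0n.
have rn : all n.-unity_root r.
  by apply/allP => z; rewrite -root_prod_XsubC -pE.
have /hasP[z _ pz] : has n.-primitive_root r by rewrite has_prim_root // sr.
by exists z.
Qed.

Lemma root_list p : exists s : seq K, p != 0 -> forall x, p.[x] = 0 -> x \in s.
Proof.
have [s sE] := closed_field_poly_normal p; exists s => p0 x px.
have : root p x by rewrite rootE px.
by rewrite sE rootZ ?lead_coef_eq0 // root_prod_XsubC.
Qed.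

Lemma root_of (n : nat) (c : K) : (0 < n)%N -> exists x, x ^+ n = c.
Proof. by move=> n0; exists (n.-root c); rewrite rootCK. Qed.
End ClosedFieldRoots.

Section Example.
Variable R : realType.
Local Notation C := (Cplx R).
Variable l : nat.
Hypothesis l2 : (1 < l)%N.

(** The polynomial of degree [l + 2] of the example. *)
Definition trinomial : {poly R[i]} := 'X^(l.+2) + 'X^2.
Local Notation f := trinomial.
(** The sum of [u ^ i] for [i < l + 2]. *)
Definition geom_sum : {poly R[i]} := \sum_(i < l.+2) 'X^i.

Lemma trinomialE (x : C) : f.[x] = x ^+ 2 * (x ^+ l + 1).
Proof. by rewrite /trinomial !hornerE mulrDr mulr1 -exprD. Qed.

Lemma size_trinomial : size f = l.+3.
Proof.
rewrite /trinomial size_polyDl ?size_polyXn //.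
by rewrite !ltnS; exact: ltnW.
Qed.

Lemma deriv_trinomial (x : C) : f^`().[x] = x * (l.+2%:R * x ^+ l + 2).
Proof.
rewrite /trinomial derivD !derivXn hornerD !hornerMn !hornerXn /= expr1 exprS.
rewrite -(mulr_natr (x * x ^+ l) l.+2) -(mulr_natr x 2).
by move: (l.+2%:R) (x ^+ l) => n y; ring.
Qed.

Lemma geomE (u : C) : (u - 1) * geom_sum.[u] = u ^+ l.+2 - 1.
Proof.
rewrite subrX1 /geom_sum horner_sum; congr (_ * _).
by apply: eq_bigr => i _; rewrite hornerXn.
Qed.

Lemma geom0 : geom_sum.[0] = 1.
Proof. by have := geomE 0; rewrite expr0n sub0r mulN1r => /oppr_inj. Qed.

Lemma geom1 : geom_sum.[1] = l.+2%:R.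
Proof.
rewrite /geom_sum horner_sum (eq_bigr (fun=> 1)).
  by rewrite sumr_const card_ord.
by move=> i _; rewrite hornerXn expr1n.
Qed.

(** The curve of pairs [(u, x)] for which [x] and [u * x] have the same image under
    the trinomial. *)
Definition on_chord (u x : C) := x ^+ l * geom_sum.[u] = - (1 + u).

Lemma on_chord_fibre u x : on_chord u x -> f.[u * x] = f.[x].
Proof.
move=> h; apply/eqP; rewrite -subr_eq0 !trinomialE; apply/eqP.
transitivity (x ^+ 2 * (u - 1) * (x ^+ l * geom_sum.[u] + (1 + u))); last first.
  by rewrite h; ring.
have -> : x ^+ 2 * (u - 1) * (x ^+ l * geom_sum.[u] + (1 + u)) =
  x ^+ 2 * (x ^+ l * ((u - 1) * geom_sum.[u]) + (u ^+ 2 - 1)) by ring.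
rewrite geomE (exprD u 2 l) (exprMn l u x); ring.
Qed.

Lemma fibre_on_chord u x : x != 0 -> u != 1 -> f.[u * x] = f.[x] -> on_chord u x.
Proof.
move=> x0 u1 /eqP; rewrite -subr_eq0 !trinomialE.
have -> : (u * x) ^+ 2 * ((u * x) ^+ l + 1) - x ^+ 2 * (x ^+ l + 1) =
   x ^+ 2 * (u - 1) * (x ^+ l * geom_sum.[u] + (1 + u)).
  have -> : x ^+ 2 * (u - 1) * (x ^+ l * geom_sum.[u] + (1 + u)) =
    x ^+ 2 * (x ^+ l * ((u - 1) * geom_sum.[u]) + (u ^+ 2 - 1)) by ring.
  rewrite geomE (exprD u 2 l) (exprMn l u x); ring.
rewrite !mulf_eq0 (negPf x0) subr_eq0 (negPf u1) /= addr_eq0.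
by move=> /eqP.
Qed.

Lemma exact_list (Q : C -> Prop) : (exists F : seq C, forall u, Q u -> u \in F) ->
  exists F : seq C, forall u, u \in F <-> Q u.
Proof.
move=> [F FP]; exists [seq u <- F | `[< Q u >]] => u; rewrite mem_filter; split.
  by move=> /andP[/asboolP].
by move=> Qu; rewrite FP // andbT; apply/asboolP.
Qed.

(** The values of [u] removed from the plane: apart from them the curve is an
    unramified covering with [l] sheets, over which the trinomial takes only
    noncritical values. *)
Definition bad (u : C) := [\/ u = - 1, geom_sum.[u] = 0 |
  exists2 x, on_chord u x & critical_values f f.[x]].

(** Every [u] on the curve over a fixed [x] is a root of the nonzero polynomial
    [x ^ l * geom_sum + 1 + u]. *)
Lemma bad_finite : exists F : seq C, forall u, u \in F <-> bad u.
Proof.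
apply: exact_list.
have /choice[rl rlP] := @root_list R[i].
pose cs := [seq x | c <- rl f^`(), x <- rl (f - f.[c]%:P)].
exists (-1 :: rl geom_sum ++ [seq u | x <- cs, u <- rl (x ^+ l *: geom_sum + 1 + 'X)]).
move=> u; rewrite inE mem_cat => -[->|gu|[x ux [c dc fc]]]; first by rewrite eqxx.
- rewrite (rlP _ _ u gu) ?orbT //.
  by apply/eqP => g0; have := geom0; rewrite g0 horner0 => /esym/eqP; rewrite oner_eq0.
apply/orP; right; apply/orP; right; apply/allpairsPdep; exists x, u; split => //.
  apply/allpairsPdep; exists c, x; split => //.
    apply: rlP dc; apply/eqP => df0; have := deriv_trinomial 1.
    rewrite df0 horner0 mul1r expr1n mulr1 => /esym/eqP.
    by rewrite -natrD pnatr_eq0.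
  apply: rlP; last by rewrite hornerD hornerN hornerC fc subrr.
  by rewrite -size_poly_eq0 size_sub_cst size_trinomial.
apply: rlP; last by rewrite !hornerE ux; ring.
apply/eqP => p0; have := geom0; have := geom1.
have := congr1 (fun p => p.[1]) p0; have := congr1 (fun p => p.[0]) p0.
rewrite !(hornerD, hornerZ, hornerC, hornerX) => + + g1 g0.
rewrite g1 g0 mulr1 addr0 => /eqP; rewrite addr_eq0 => /eqP ->.
have -> : l.+2%:R = l%:R + 2 :> R[i] by rewrite -natrD addn2.
have -> : -1 * (l%:R + 2) + 1 + 1 = - l%:R :> R[i] by ring.
by move/eqP; rewrite oppr_eq0 pnatr_eq0; case: (l) l2.
Qed.


Lemma noncritical_Xn (v : C) : v != 0 -> ~ critical_values 'X^l v.
Proof.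
move=> v0 [z]; rewrite derivXn hornerMn !hornerXn => /eqP.
rewrite mulrn_eq0 expf_eq0 => /orP[/eqP l0|/andP[_ /eqP ->]].
  by move: l2; rewrite l0.
by rewrite expr0n; case: (l) l2 => // n _ /esym/eqP; rewrite (negPf v0).
Qed.

Lemma size_Xl : size ('X^l : {poly R[i]}) = l.+1.
Proof. by rewrite size_polyXn. Qed.

(** The common value of [x ^ l] for the points of the curve over [u]. *)
Definition chord_power (u : C) : C := - (1 + u) / geom_sum.[u].

Lemma on_chordE u x : geom_sum.[u] != 0 -> on_chord u x <-> x ^+ l = chord_power u.
Proof.
move=> g0; rewrite /on_chord /chord_power; split=> [<-|->].
  by rewrite mulfK.
by rewrite mulfVK.
Qed.

Lemma id_cvg (v : C) : {for v, continuous (@id C)}.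
Proof. exact: cvg_id. Qed.

Lemma horner_cvg (p : {poly R[i]}) (v : C) : {for v, continuous (fun u : C => p.[u] : C)}.
Proof. exact: (@horner_continuous R[i]). Qed.

Lemma continuous_chord_quotient (p : {poly R[i]}) (v : C) : p.[v] != 0 ->
  {for v, continuous (fun u : C => - (1 + u) / p.[u] : C)}.
Proof.
move=> g0; have h1 := @horner_cvg (- (1 + 'X)) v.
have h2 := continuousV g0 (@horner_cvg p v).
have := @continuousM R[i] C _ _ v h1 h2.
by congr continuous_at; apply/funext => u /=; rewrite !hornerE.
Qed.

Section Reach.
Variables (t0 : C) (z0 : 'I_(size f).-1 -> C -> C) (i j : 'I_(size f).-1).
Local Notation reach := (pair_reach t0 z0 i j).

(** All pairs [(x, u * x)] on the curve over [u] are reached. *)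
Definition chord_reached (u : C) :=
  forall x : C, on_chord u x -> reach x (u * x).

Lemma chord_reached_locally_constant v : ~ bad v ->
  \forall u \near v, chord_reached u <-> chord_reached v.
Proof.
move=> nb.
have gv : geom_sum.[v] != 0 by apply/eqP => gv; apply: nb; apply: Or32.
have qv : chord_power v != 0.
  rewrite mulf_neq0 ?invr_eq0 // oppr_eq0 addrC addr_eq0.
  by apply/eqP => v1; apply: nb; apply: Or31.
have sX : (1 < size ('X^l : {poly R[i]}))%N by rewrite size_Xl ltnS ltnW.
have [h [hn _]] := local_sections sX (noncritical_Xn qv).
have qc : {for v, continuous chord_power} := continuous_chord_quotient gv.
have near_g : \forall u \near v, geom_sum.[u] != 0.
  exact: (near_horner_neq0 (@id_cvg v) gv).
have near_h : \forall u \near v, [/\ forall k, root_germ 'X^l (chord_power u) (h k)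
    & injective (fun k => h k (chord_power u))].
  by apply: nearS (qc _ hn) => u [].
have hk_on u k : geom_sum.[u] != 0 -> root_germ 'X^l (chord_power u) (h k) ->
    on_chord u (h k (chord_power u)).
  by move=> gu /root_germ_root; rewrite hornerXn => e; apply/on_chordE.
have near_k : \forall u \near v, forall k,
    reach (h k (chord_power u)) (u * h k (chord_power u)) <->
    reach (h k (chord_power v)) (v * h k (chord_power v)).
  apply: near_all => k; have [hv _] := nbhs_singleton near_h.
  have Xc : {for v, continuous (fun u => h k (chord_power u))}.
    by apply: continuous_comp; [exact: qc|exact: (root_germ_cvg (hv k))].
  have sf : (1 < size f)%N by rewrite size_trinomial.
  refine (@pair_reach_near R f sf t0 z0 i j (fun u => h k (chord_power u))
    (fun u => u * h k (chord_power u)) v _ Xc _ _).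
  - by move=> cv; apply: nb; apply: Or33; exists (h k (chord_power v)) => //; exact: hk_on.
  - exact: (@continuousM R[i] C id _ v (@id_cvg v) Xc).
  - apply: nearS (nearI near_g near_h) => u [gu [hu _]].
    by apply: on_chord_fibre; exact: hk_on.
have char u : geom_sum.[u] != 0 -> (forall k, root_germ 'X^l (chord_power u) (h k)) ->
    injective (fun k => h k (chord_power u)) ->
    chord_reached u <-> forall k, reach (h k (chord_power u)) (u * h k (chord_power u)).
  move=> gu hu hi; split=> [cr k|hr x /(on_chordE _ gu) ux]; first exact/cr/hk_on.
  have [||k <-//] := @fibre_exhaustive _ 'X^l (chord_power u) _ x sX hi.
    by move=> k; exact: root_germ_root (hu k).
  by rewrite hornerXn.
have [hv hvi] := nbhs_singleton near_h.
apply: nearS (nearI near_g (nearI near_h near_k)) => u [gu [[hu hui] hk]].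
by rewrite (char u) // (char v) //; split=> H k; apply/hk/H.
Qed.

Lemma chord_reached_everywhere u v : ~ bad u -> ~ bad v ->
  chord_reached u -> chord_reached v.
Proof.
move=> nu nv; have [F FP] := bad_finite.
apply: (iffLR (@locally_constant_plane R F chord_reached u v _ _ _)).
- by move=> w wF; apply: chord_reached_locally_constant => /FP; apply/negP.
- by apply/negP => /FP.
- by apply/negP => /FP.
Qed.
End Reach.

End Example.

Section Pole.
Variable R : realType.
Local Notation C := (Cplx R).
Variable l : nat.
Hypothesis l2 : (1 < l)%N.
Local Notation f := (trinomial R l).
Local Notation geom_sum := (geom_sum R l).

(** A primitive root of unity of order [l + 2] is a simple zero. *)
Lemma geom_simple_root : exists (rho : C) (T : {poly R[i]}),
  [/\ geom_sum = T * ('X - rho%:P), T.[rho] != 0 & rho != -1].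
Proof.
have [rho pr] := prim_root_exists R[i] (ltn0Sn l.+1).
have r1 : rho != 1.
  by apply/eqP => e; have := prim_order_dvd pr 1; rewrite e expr1n eqxx dvdn1.
have rN1 : rho != -1.
  apply/eqP => e; have := prim_order_dvd pr 2.
  by rewrite e sqrrN expr1n eqxx => /(dvdn_leq (isT : 0 < 2)%N); rewrite !ltnS; case: (l) l2.
have gr : geom_sum.[rho] = 0.
  apply/eqP; have := @geomE R l rho; rewrite (prim_expr_order pr) subrr => /eqP.
  by rewrite mulf_eq0 subr_eq0 (negPf r1).
have /factor_theorem[T TE] : root geom_sum rho by rewrite rootE gr.
exists rho, T; split => //; apply/eqP => T0.
have := congr1 (fun p => p^`().[rho]) (subrX1 ('X : {poly R[i]}) l.+2).
have -> : \sum_(i < l.+2) 'X^i = T * ('X - rho%:P) by rewrite -TE.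
rewrite derivB derivXn -[1]/(1%:P) derivC subr0 hornerMn hornerXn.
have -> : (('X - 1%:P) * (T * ('X - rho%:P)))^`().[rho] = 0.
  by rewrite !derivM !derivB !derivC derivX !(hornerD, hornerM, hornerN, hornerC, hornerX) T0; ring.
move=> /eqP; rewrite mulrn_eq0 /= expf_eq0 /=.
by rewrite (prim_root_eq0 pr).
Qed.

(** There is a cycle, based at some [t0], for which all the points of the curve
    over some [u0] are reached: near the simple zero [rho], the [l] points over
    [rho + w ^ l] are the values of the function [X] at the [l] numbers with the
    same [l]-th power as [w], and the punctured disc of the variable [w] is
    connected. *)
Lemma chord_base : exists t0 (z0 : 'I_(size f).-1 -> C -> C) i j (u0 : C),
  [/\ ~ critical_values f t0, forall k, root_germ f t0 (z0 k),
      injective (fun k => z0 k t0), i != j &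
      ~ bad l u0 /\ chord_reached t0 z0 i j u0].
Proof.
have sf : (1 < size f)%N by rewrite size_trinomial.
have [rho [T [TE T0 rN1]]] := geom_simple_root.
pose q (u : C) : C := - (1 + u) / T.[u].
have q0 : q rho != 0.
  by rewrite mulf_neq0 ?invr_eq0 // oppr_eq0 addrC addr_eq0.
have [H0 H0E] := root_of (q rho) (ltnW l2).
have H0E' : ('X^l).[H0] = q rho by rewrite hornerXn.
have [G [gG G0 _]] := local_root_germ (noncritical_deriv (noncritical_Xn l2 q0) H0E').
rewrite H0E' in gG G0.
have near_rho : \forall u \near rho, T.[u] != 0 /\ root_germ 'X^l (q u) G.
  apply: nearI; first exact: (near_horner_neq0 (@id_cvg R rho) T0).
  have qc : {for rho, continuous q} := continuous_chord_quotient T0.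
  exact: (@near_comp R rho q (fun v => root_germ 'X^l v G) qc (root_germ_near gG)).
pose U (w : C) : C := ('X^l + rho%:P).[w].
have UE w : U w = w ^+ l + rho by rewrite /U hornerD hornerXn hornerC.
have U0 : U 0 = rho by rewrite UE expr0n; case: (l) l2 => //= n _; rewrite add0r.
have [e e0 eU] : exists2 e : R[i], 0 < e & forall w, `|0 - w| < e ->
    T.[U w] != 0 /\ root_germ 'X^l (q (U w)) G.
  have Uc : {for 0, continuous U} by exact: horner_cvg.
  apply: near_norm_ball.
  apply: (@near_comp R 0 U (fun v => T.[v] != 0 /\ root_germ 'X^l (q v) G) Uc).
  by rewrite U0.
pose X (w : C) : C := w^-1 * G (q (U w)).
have X_on w : w != 0 -> `|0 - w| < e -> on_chord l (U w) (X w).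
  move=> w0 /eU[TU /root_germ_root]; rewrite hornerXn => GE.
  rewrite /on_chord TE /X exprMn GE /q hornerM hornerXsubC (UE w).
  have -> : w ^+ l + rho - rho = w ^+ l by rewrite addrK.
  rewrite -UE exprVn; field.
  by rewrite TU expf_neq0.
have [F FP] := bad_finite R l2.
have [W WP] : exists W : seq C, forall w, w \in W <-> w = 0 \/ bad l (U w).
  apply: exact_list.
  have /choice[rl rlP] := @root_list R[i].
  exists (0 :: [seq w | v <- F, w <- rl ('X^l + (rho - v)%:P)]).
  move=> w [->|/FP bw]; first by rewrite mem_head.
  rewrite inE; apply/orP; right; apply/allpairsPdep; exists (U w), w; split => //.
  apply: rlP.
    apply/eqP => /(congr1 (fun p : {poly R[i]} => p`_l)) /eqP.
    rewrite coefD coefXn eqxx coefC coef0; case: (l) l2 => //= n _.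
    by rewrite addr0 oner_eq0.
  by rewrite hornerD hornerXn hornerC UE; ring.
(* A positive real number is taken, off the real parts of the points of [W]. *)
have [w0 w0e w0W] : exists2 w0 : C, `|0 - w0| < e & w0 \notin W.
  have : \forall s \near (0 : R)^'+, `|0 - ((s%:C)%C : C)| < e.
    apply: cvg_within.
    have n0 : nbhs (((0 : R)%:C)%C : C) [set v : C | `|0 - v| < e].
      by rewrite rmorph0; exact: near_dist_lt.
    exact: (@real_complex_continuous R 0 _ n0).
  have := near_right_notin [seq complex.Re w | w <- W] => nW ne.
  near (0 : R)^'+ => s; exists (s%:C)%C; first by near: s.
  apply/negP => sW; have : s \notin [seq complex.Re w | w <- W] by near: s.
  by move=> /mapP; apply; exists (s%:C)%C.
have good w : w \notin W -> w != 0 /\ ~ bad l (U w).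
  move=> wW; split; first by apply: contraNneq wW => ->; apply/WP; left.
  by move=> bw; move/negP: wW; apply; apply/WP; right.
have [w00 nb0] := good w0 w0W.
have on0 := X_on w0 w00 w0e.
pose t0 : C := f.[X w0].
have nct : ~ critical_values f t0.
  by move=> ct; apply: nb0; apply: Or33; exists (X w0).
have [z0 [z0n _]] := local_sections sf nct.
have [_ z0g z0i] := nbhs_singleton z0n.
have [i iE] := fibre_exhaustive sf z0i (fun k => root_germ_root (z0g k)) (erefl t0).
have [j jE] := fibre_exhaustive sf z0i (fun k => root_germ_root (z0g k))
  (on_chord_fibre on0).
exists t0, z0, i, j, (U w0); split => //.
  apply/eqP => ij; move: jE; rewrite -ij iE => XE.
  have Xd := noncritical_deriv nct (erefl t0).
  have X0 : X w0 != 0.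
    by apply: contraNneq Xd => ->; rewrite deriv_trinomial mul0r.
  have U1 : U w0 = 1.
    by apply: (mulIf X0); rewrite mul1r -XE.
  move: on0 Xd; rewrite /on_chord U1 geom1 deriv_trinomial // mulrC => ->.
  by rewrite -[1 + 1]/2 addNr mulr0 eqxx.
split => // x xon.
pose reachW w := pair_reach t0 z0 i j (X w) (U w * X w).
have reach0 : reachW w0.
  exists z0; split; [|exact: iE|exact: jE].
  have nz : \forall u \near t0, ~ critical_values f u /\ forall k, root_germ f u (z0 k).
    by apply: nearS z0n => u [].
  have [r r0 rP] := continues_near nz.
  by apply: rP; rewrite subrr normr0.
have reach_lc w : `|0 - w| < e -> w \notin W -> \forall v \near w, reachW v <-> reachW w.
  move=> we wW; have [wn0 nbw] := good w wW.
  have Uc : {for w, continuous U} by exact: horner_cvg.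
  have [TU gU] := eU w we.
  have Xc : {for w, continuous X}.
    have c1 : {for w, continuous (fun w : C => q (U w))}.
      by apply: continuous_comp; [exact: Uc|exact: continuous_chord_quotient].
    have c2 : {for w, continuous (fun w : C => G (q (U w)))}.
      by apply: continuous_comp; [exact: c1|exact: (root_germ_cvg gU)].
    have c3 := continuousV wn0 (@id_cvg R w).
    exact: (@continuousM R[i] C _ _ w c3 c2).
  refine (@pair_reach_near R f sf t0 z0 i j X (fun w => U w * X w) w _ Xc _ _).
  - by move=> cw; apply: nbw; apply: Or33; exists (X w) => //; exact: X_on.
  - exact: (@continuousM R[i] C _ _ w Uc Xc).
  - have n1 : \forall v \near w, 'X.[v] != 0 :> R[i].
      by apply: (near_horner_neq0 (@id_cvg R w)); rewrite hornerX.
    have n2 : \forall v \near w, `|w - v| < e - `|0 - w|.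
      by apply: near_dist_lt; rewrite subr_gt0.
    apply: nearS (nearI n1 n2) => v [v0 wv]; rewrite hornerX in v0.
    apply: on_chord_fibre; apply: X_on => //.
    rewrite (_ : 0 - v = (0 - w) + (w - v)); last by ring.
    by apply: le_lt_trans (ler_normD _ _) _; rewrite -ltrBrDl.
have g0 : geom_sum.[U w0] != 0 by apply/eqP => g0; apply: nb0; apply: Or32.
have xX : x ^+ l = X w0 ^+ l.
  by move/(on_chordE _ g0): xon => ->; move/(on_chordE _ g0): on0.
have nX0 (y : C) : y ^+ l = X w0 ^+ l -> y != 0.
  move=> yX; apply/eqP => y0; apply: nb0; apply: Or31.
  have : y ^+ l = chord_power l (U w0) by rewrite yX; move/(on_chordE _ g0): on0.
  rewrite y0 expr0n (_ : (l == 0)%N = false); last by case: (l) l2.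
  move=> /esym/eqP; rewrite mulf_eq0 invr_eq0 (negPf g0) orbF oppr_eq0 addrC addr_eq0.
  by move=> /eqP.
have x0 := nX0 x xX; have X0 := nX0 (X w0) erefl.
(* [w] has the same [l]-th power as [w0], and [X w = x]. *)
pose w := w0 * (X w0 / x).
have y1 : (X w0 / x) ^+ l = 1 by rewrite exprMn exprVn xX divff // expf_neq0.
have wl : w ^+ l = w0 ^+ l by rewrite exprMn y1 mulr1.
have Uw : U w = U w0 by rewrite !UE wl.
have we : `|0 - w| < e.
  rewrite sub0r normrN normrM; have /eqP -> : `|X w0 / x| == 1.
    by rewrite -(@pexpr_eq1 _ _ l) // ?(ltnW l2) // -normrX y1 normr1.
  by rewrite mulr1 -normrN -[- w0]add0r.
have wn0 : w != 0 by rewrite mulf_neq0 // mulf_neq0 // invr_neq0.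
have wW : w \notin W.
  by apply/negP => /WP[w0'|]; [rewrite w0' eqxx in wn0|rewrite Uw].
have XE k : U (w0 * k) = U w0 -> X (w0 * k) = k^-1 * X w0.
  by move=> Uk; rewrite /X Uk invfM (mulrC w0^-1) mulrA.
have -> : x = X w.
  by rewrite (XE _ Uw) invfM invrK mulrAC mulVf ?mul1r.
rewrite -Uw; apply: (iffLR (@locally_constant_disc R 0 e W reachW w0 w _ _ _ _ _)) => //.
Unshelve. all: by end_near. Qed.
End Pole.

(** * Zeros of the integral of x^(l+1) along a simple cycle of the trinomial *)

Section CardSeq.
Local Open Scope card_scope.

Lemma card_ge_seq (T : eqType) (s : seq T) (A : set T) : uniq s ->
  (forall x, x \in s -> A x) -> `I_(size s) #<= A.
Proof.
case: s => [|x0 s'] us sA; first by rewrite II0 card_ge0.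
move: us sA; set s := x0 :: s' => us sA.
apply: (@card_le_trans _ _ _ (nth x0 s @` `I_(size s))).
  have : nth x0 s @` `I_(size s) #= `I_(size s).
    apply: inj_card_eq => i j; rewrite !inE /= => si sj /eqP.
    by rewrite nth_uniq // => /eqP.
  by rewrite card_eq_le => /andP[].
by apply: subset_card_le => _ [i /= si <-]; apply/sA/mem_nth.
Qed.

Lemma card_le_seq (T : eqType) (s : seq T) (A : set T) :
  (forall x, A x -> x \in s) -> A #<= `I_(size s).
Proof.
move=> As; case: s As => [|x0 s'] As.
  have -> : A = set0 by apply/seteqP; split => // x /As.
  exact: card_ge0.
apply: (@card_le_trans _ _ _ (nth x0 (x0 :: s') @` `I_(size (x0 :: s')))).
  apply: subset_card_le => x /As xs.
  by exists (index x (x0 :: s')); [rewrite /mkset index_mem|exact: nth_index].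
exact: card_image_le.
Qed.
End CardSeq.

Section Zeros.
Variable R : realType.
Local Notation C := (Cplx R).

Lemma near_notin (L : seq C) (t : C) : \forall u \near t, u \in L -> u = t.
Proof.
elim: L => [|a L ih]; first by near=> u.
have [->|at_] := eqVneq a t.
  by apply: nearS ih => u h; rewrite inE => /orP[/eqP|].
have nt : \forall u \near t, `|t - u| < `|t - a|.
  by apply: near_dist_lt; rewrite normr_gt0 subr_eq0 eq_sym.
apply: nearS (nearI ih nt) => u [h ua]; rewrite inE => /orP[/eqP uE|//].
by rewrite uE ltxx in ua.
Unshelve. all: by end_near. Qed.

Lemma isolated_in_list (L : seq C) (A : set C) :
  (forall t, A t -> t \in L) -> A `<=` isolated A.
Proof.
move=> AL t At; split; first by rewrite inE.
exists [set u | u \in L -> u = t]; first exact: near_notin.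
by apply/seteqP; split=> [u [h /AL /h]|u ->].
Qed.

Lemma simple_integral (f : {poly R[i]}) (c : Defs.cycle f) g z (t : C) i j :
  (forall k, coef c k = (k == i)%:R - (k == j)%:R) ->
  integral_along c g z t = g.[z i t] - g.[z j t].
Proof.
move=> cE; rewrite /integral_along.
under eq_bigr => k _ do rewrite cE rmorphB /= mulrBl.
rewrite big_split /= sumrN; congr (_ - _).
- rewrite (bigD1 i) //= eqxx rmorph1 mul1r big1 ?addr0 // => k /negPf ->.
  by rewrite mul0r.
- rewrite (bigD1 j) //= eqxx rmorph1 mul1r big1 ?addr0 // => k /negPf ->.
  by rewrite mul0r.
Qed.

Lemma integral_branchP (f : {poly R[i]}) (c : Defs.cycle f) g (t : C) F : integral_branch c g t F <->
  exists2 z, continues f (base c) (branch c) t z & F = integral_along c g z.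
Proof.
split=> [[gam [z [h1 h2 h3 h4 h5]]]|[z' [gam [z [h1 h2 h3 h4 ->]]] ->]].
  by exists (fun j => z j 1) => //; exists gam, z.
by exists gam, z.
Qed.

Variable l : nat.
Hypothesis l2 : (1 < l)%N.
Local Notation f := (trinomial R l).

Definition simple_coef n (i j k : 'I_n) : int := (k == i)%:R - (k == j)%:R.

Lemma simple_coef_sum n (i j : 'I_n) : \sum_k simple_coef i j k = 0.
Proof.
rewrite /simple_coef big_split /= sumrN (bigD1 i) //= eqxx.
rewrite big1 => [|k /negPf -> //]; rewrite (bigD1 j) //= eqxx.
by rewrite big1 ?addr0 ?subrr // => k /negPf ->.
Qed.

Lemma geom_unity (w : C) : w ^+ l.+1 = 1 -> w != 1 -> (geom_sum R l).[w] = 1.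
Proof.
move=> w1 wn1; have := geomE l w; rewrite exprS w1 mulr1 => h.
by apply: (mulfI (_ : w - 1 != 0)); rewrite ?subr_eq0 // mulr1.
Qed.

(** The integral of [x ^ (l + 1)] along this cycle vanishes at each reached point of
    the curve over an [(l + 1)]-th root of unity, and has no other zeros. *)
Lemma example_cycle : exists c : Defs.cycle f,
  [/\ simple_cycle c, ~ germ_eq (base c) (abelian_integral c 'X) (fun=> 0),
    (forall u x : C, ~ bad l u -> on_chord l u x -> u ^+ l.+1 = 1 ->
       integral_zeros c 'X^(l.+1) f.[x])
    & exists L : seq C, forall t, integral_zeros c 'X^(l.+1) t -> t \in L].
Proof.
have [t0 [z0 [i [j [u0 [nc z0g z0i ij [nb0 cr0]]]]]]] := chord_base R l2.
pose c := Cycle nc z0g z0i (simple_coef_sum i j).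
have cE k : coef c k = (k == i)%:R - (k == j)%:R by [].
exists c; split.
- by exists i, j.
- move=> /nbhs_singleton; rewrite /abelian_integral (simple_integral _ _ _ cE).
  rewrite !hornerX => /eqP; rewrite subr_eq0 => /eqP /z0i /eqP.
  by rewrite (negPf ij).
- move=> u x nb ux u1.
  have [zs [cz zi zj]] := chord_reached_everywhere l2 nb0 nb cr0 ux.
  split; first by move=> cx; apply: nb; apply: Or33; exists x.
  exists (integral_along c 'X^(l.+1) zs); first by apply/integral_branchP; exists zs.
  rewrite (simple_integral _ _ _ cE) zi zj !hornerXn exprMn u1 mul1r.
  exact: subrr.
- have /choice[rl rlP] := @root_list R[i].
  exists [seq f.[x] | w <- rl ('X^(l.+1) - 1), x <- rl ('X^l + (1 + w)%:P)].
  move=> t [nct [F /integral_branchP[z cz ->]]].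
  rewrite (simple_integral _ _ _ cE) !hornerXn => /eqP; rewrite subr_eq0 => /eqP xy.
  have [_ zg] := continues_end cz.
  have zij : z i t != z j t.
    by apply: (continues_inj cz); apply/eqP => /z0i /eqP; rewrite (negPf ij).
  have fx := root_germ_root (zg i); have fy := root_germ_root (zg j).
  have x0 : z i t != 0.
    by apply: contraNneq (noncritical_deriv nct fx) => ->; rewrite deriv_trinomial mul0r.
  pose w := z j t / z i t.
  have yE : z j t = w * z i t by rewrite /w mulfVK.
  have w1 : w != 1 by apply: contraNneq zij => w1; rewrite yE w1 mul1r.
  have wl : w ^+ l.+1 = 1 by rewrite /w exprMn exprVn -xy divff // expf_neq0.
  have wx : on_chord l w (z i t) by apply: fibre_on_chord => //; rewrite -yE fx fy.
  rewrite /on_chord geom_unity // mulr1 in wx.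
  apply/allpairsPdep; exists w, (z i t); split; last by rewrite fx.
    apply: rlP; last by rewrite hornerD hornerN hornerC hornerXn wl subrr.
    by rewrite -size_poly_eq0 size_XnsubC.
  apply: rlP; last by rewrite hornerD hornerXn hornerC wx addNr.
  by rewrite -size_poly_eq0 size_polyDl size_polyXn // (leq_ltn_trans (size_polyC_leq1 _)) // ltnS ltnW.
Qed.
End Zeros.

Section Count.
Variable R : realType.
Local Notation C := (Cplx R).
Variable l : nat.
Hypothesis l2 : (1 < l)%N.
Local Notation f := (trinomial R l).

(** The quantity w + 2 + 1 / w, which determines [w] up to inversion. *)
Definition trace_of (w : C) : C := (1 + w) ^+ 2 / w.

Lemma trace_of_inj (w w' : C) : w != 0 -> w' != 0 -> trace_of w = trace_of w' ->
  w = w' \/ w * w' = 1.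
Proof.
move=> w0 w'0 /eqP; rewrite /trace_of eqr_div // -subr_eq0.
have -> : (1 + w) ^+ 2 * w' - (1 + w') ^+ 2 * w = (w - w') * (w * w' - 1) by ring.
by rewrite mulf_eq0 !subr_eq0 => /orP[/eqP|/eqP]; [left|right].
Qed.

Section Point.
Variables (w x : C).
Hypothesis (w1 : w ^+ l.+1 = 1) (wn1 : w != 1) (wx : x ^+ l = - (1 + w)).

Lemma unity_on_chord : on_chord l w x.
Proof. by rewrite /on_chord geom_unity // mulr1. Qed.

Lemma unity_value : f.[x] = - w * x ^+ 2.
Proof. by rewrite trinomialE wx; ring. Qed.

Lemma unity_neq0 : w != 0.
Proof. by apply: contra_eqN w1 => /eqP ->; rewrite expr0n /= eq_sym oner_eq0. Qed.

(** The [l]-th power of the zero [t] depends only on [w]. *)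
Lemma unity_value_power : f.[x] ^+ l = (-1) ^+ l * trace_of w.
Proof.
rewrite unity_value exprMn -exprM mulnC exprM wx -[in LHS](mulN1r w) exprMn.
have -> : w ^+ l = w^-1.
  by apply: (mulfI unity_neq0); rewrite -exprS w1 divff // unity_neq0.
by rewrite sqrrN /trace_of -mulrA; congr (_ * _); rewrite mulrC.
Qed.
End Point.

(** The value of [trace_of w] at which the zeros over [w] are critical values. *)
Definition critical_trace : C :=
  (-1) ^+ l * ((2 / l.+2%:R) ^+ 2 * (1 - 2 / l.+2%:R) ^+ l).

Lemma unity_not_bad (w : C) : w ^+ l.+1 = 1 -> w != 1 -> w != -1 ->
  trace_of w != critical_trace -> ~ bad l w.
Proof.
move=> w1 wn1 wN1 wt [wE|g0|[x xon [c /eqP dc fc]]].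
- by rewrite wE eqxx in wN1.
- by have := geom_unity w1 wn1; rewrite g0 => /esym/eqP; rewrite oner_eq0.
have wx : x ^+ l = - (1 + w) by move: xon; rewrite /on_chord geom_unity // mulr1.
have x0 : x != 0.
  apply/eqP => x0; move: wx; rewrite x0 expr0n (_ : (l == 0)%N = false).
    by move=> /esym/eqP; rewrite oppr_eq0 addrC addr_eq0 (negPf wN1).
  by case: (l) l2.
have m0 : l.+2%:R != 0 :> R[i] by rewrite pnatr_eq0.
have c0 : c != 0.
  apply/eqP => c0; move: fc; rewrite c0 trinomialE expr0n /= mul0r (unity_value wx).
  move=> /esym/eqP; rewrite mulf_eq0 oppr_eq0 (negPf (unity_neq0 w1)).
  by rewrite expf_eq0 (negPf x0).
have cl : c ^+ l = - (2 / l.+2%:R).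
  move: dc; rewrite deriv_trinomial // mulf_eq0 (negPf c0) /= addr_eq0 => /eqP h.
  by apply: (mulfI m0); rewrite h mulrN mulrCA divff // mulr1.
have := unity_value_power w1 wx; rewrite -fc trinomialE cl exprMn -exprM mulnC exprM cl.
rewrite sqrrN addrC => h; move/eqP: wt; apply; rewrite /critical_trace h mulrA.
by rewrite -exprMn mulrNN mulr1 expr1n mul1r.
Qed.

(** With [q = l./2], the zeros counted are those over [q - 1] powers [e ^ j] with
    [1 <= j <= q], one of which may have to be omitted because it gives critical
    values, and, over each of them, those at [q] of the [l] points, on which
    [x ^ 2] is injective. *)
Lemma example_count : (1 < l./2)%N -> exists c : Defs.cycle f,
  [/\ simple_cycle c, ~ germ_eq (base c) (abelian_integral c 'X) (fun=> 0)
    & (`I_((l./2).-1 * l./2) #<= isolated_zeros c 'X^(l.+1))%card].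
Proof.
move=> hl; have [c [cs cn cz [L cL]]] := example_cycle R l2.
exists c; split => //.
have [e pe] := @prim_root_exists R[i] l.+1 isT.
have [xi pxi] := @prim_root_exists R[i] l (ltnW l2).
set q := l./2 in hl *; pose p' := q.-1.
have p'q : p'.+1 = q by rewrite prednK // ltnW.
have q2 : (q.*2 <= l)%N by have := odd_double_half l; rewrite -/q; lia.
pose w (j : 'I_p'.+1) := e ^+ j.+1.
have jq (j : 'I_p'.+1) : (j < q)%N by rewrite -p'q.
have w1 j : w j ^+ l.+1 = 1 by rewrite /w exprAC (prim_expr_order pe) expr1n.
have ww j k : w j * w k != 1.
  rewrite /w -exprD -(prim_order_dvd pe); apply/negP => /dvdn_leq.
  rewrite addSn => /(_ isT); rewrite leqNgt; apply/negP; rewrite negbK.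
  rewrite ltnS; apply: leq_trans q2; rewrite -addnn -addSnnS.
  by have := jq j; have := jq k; lia.
have wn1 j : w j != 1.
  by apply/eqP => wj; have := ww j j; rewrite wj mulr1 eqxx.
have wN1 j : w j != -1.
  by apply/eqP => wj; have := ww j j; rewrite wj mulrNN mulr1 eqxx.
have wt j k : trace_of (w j) = trace_of (w k) -> j = k.
  move=> /trace_of_inj[||/eqP|wjk]; try exact: unity_neq0.
    rewrite /w (eq_prim_root_expr pe) !modn_small.
    - by rewrite eqSS => /eqP /val_inj.
    - by have := jq k; lia.
    - by have := jq j; lia.
  by have := ww j k; rewrite wjk eqxx.
have [j0 j0P] : exists j0, forall j, j != j0 -> trace_of (w j) != critical_trace.
  have [[j0 j0E]|nj] := pselect (exists j, trace_of (w j) = critical_trace).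
    by exists j0 => j; apply: contra_neq => jE; apply: wt; rewrite jE.
  by exists ord0 => j _; apply/eqP => jE; apply: nj; exists j.
have /choice[a aE] : forall j, exists x, x ^+ l = - (1 + w j).
  by move=> j; apply: root_of (ltnW l2).
pose x (jk : 'I_p' * 'I_q) := a (lift j0 jk.1) * xi ^+ jk.2.
have xE jk : x jk ^+ l = - (1 + w (lift j0 jk.1)).
  by rewrite /x exprMn aE exprAC (prim_expr_order pxi) expr1n mulr1.
pose Phi jk : C := f.[x jk].
have Phi_inj : injective Phi.
  move=> [j k] [j' k'] h.
  have jj' : j = j'.
    apply: (@lift_inj _ j0); apply: wt.
    have s0 : (-1) ^+ l != 0 :> R[i] by rewrite expf_neq0 // oppr_eq0 oner_eq0.
    apply: (mulfI s0); rewrite -(unity_value_power (w1 _) (xE (j, k))).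
    by rewrite -(unity_value_power (w1 _) (xE (j', k'))) -/(Phi _) h.
  rewrite -jj' in h *; congr (_, _); apply/val_inj => /=.
  have a0 : a (lift j0 j) != 0.
    apply/eqP => a0; have := aE (lift j0 j); rewrite a0 expr0n.
    rewrite (_ : (l == 0)%N = false); last by case: (l) l2.
    by move=> /esym/eqP; rewrite oppr_eq0 addrC addr_eq0 (negPf (wN1 _)).
  move: h; rewrite /Phi (unity_value (xE (j, k))) (unity_value (xE (j, k'))) /=.
  move=> /mulfI; rewrite oppr_eq0 => /(_ (unity_neq0 (w1 _))).
  rewrite /x /= !exprMn => /mulfI; rewrite expf_neq0 // => /(_ isT) /eqP.
  rewrite -!exprM (eq_prim_root_expr pxi) !modn_small; first by move=> /eqP; lia.
    by have := ltn_ord k'; lia.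
  by have := ltn_ord k; lia.
have -> : (q.-1 * q)%N = size (codom Phi).
  by rewrite size_codom card_prod !card_ord.
apply: card_ge_seq; first by rewrite map_inj_uniq ?enum_uniq.
move=> _ /codomP[jk ->]; apply: (isolated_in_list cL); apply: cz (w1 (lift j0 jk.1)).
  apply: unity_not_bad => //; apply: j0P; rewrite eq_sym; exact: neq_lift.
exact: unity_on_chord.
Qed.
End Count.

(** * A polynomial equation satisfied by the branches of an integral *)

Lemma size_det_leq (K : comNzRingType) n (B : 'M[{poly K}]_n) b :
  (forall i j, size (B i j) <= b)%N -> (size (\det B) <= (n * b).+1)%N.
Proof.
move=> Bb; apply: leq_trans (size_sum _ _ _) _; apply/bigmax_leqP => s _.
rewrite mulr_sign; have -> (b0 : bool) (q : {poly K}) :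
    size (if b0 then - q else q) = size q by case: b0; rewrite ?size_polyN.
apply: leq_trans (size_poly_prod_leq _ _) _; apply: leq_trans (leq_subr _ _) _.
rewrite ltnS -[n in (n * b)%N]card_ord -sum_nat_const.
exact: leq_sum.
Qed.

Section Annihilator.
Variable K : fieldType.

(** Expansion of a polynomial in base [f]. *)
Lemma base_expansion (f p : {poly K}) (d : nat) : (0 < d)%N -> size f = d.+1 ->
  exists G : 'I_d -> {poly K},
    (forall k, (size (G k) <= size p)%N) /\ p = \sum_k (G k \Po f) * 'X^k.
Proof.
move=> d0 sf; have f0 : f != 0 by rewrite -size_poly_eq0 sf.
have [n] := ubnP (size p); elim: n p => // n ih p; rewrite ltnS => pn.
have [->|p0] := eqVneq p 0.
  exists (fun=> 0); split=> [k|]; first by rewrite size_poly0.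
  by rewrite big1 // => k _; rewrite comp_poly0 mul0r.
have sp : (0 < size p)%N by rewrite lt0n size_poly_eq0.
have sq : (size (p %/ f)%R < size p)%N by rewrite size_divp // sf ltn_subrL d0.
have [G [sG qE]] := ih (p %/ f) (leq_trans sq pn).
exists (fun k => 'X * G k + ((p %% f)`_k)%:P); split=> [k|].
  apply: leq_trans (size_polyD _ _) _; rewrite geq_max.
  rewrite (leq_trans (size_polyC_leq1 _)) // andbT.
  apply: leq_trans (size_polyMleq _ _) _; rewrite size_polyX add2n /=.
  exact: leq_ltn_trans (sG k) sq.
under eq_bigr => k _ do
  rewrite comp_polyD comp_polyM comp_polyX comp_polyC mulrDl -mulrA.
rewrite big_split /= -mulr_sumr -qE mulrC {1}(divp_eq p f); congr (_ + _).
have sr : (size (p %% f)%R <= d)%N by rewrite -ltnS -sf ltn_modp.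
have {1}-> : p %% f = \poly_(i < d) (p %% f)`_i.
  apply/polyP => i; rewrite coef_poly; case: ltnP => // di.
  by rewrite nth_default // (leq_trans sr).
by rewrite poly_def; apply: eq_bigr => k _; rewrite mul_polyC.
Qed.

(** A bound for the sizes in [t] of the coefficients of the characteristic
    polynomial of [annihilator]; the matrix has rows indexed by the exponents of
    the monomials in the [d] roots, with all exponents less than [d]. *)
Definition annihilator_size (d s : nat) : nat :=
  (#|{: {ffun 'I_d -> 'I_d}}| * (s + d)).+1.

(** The sums of the values of [g] at roots of [f - t], with fixed coefficients,
    satisfy a monic equation over the polynomials in [t]: they are eigenvalues of
    a matrix, for the eigenvector of all monomials in the roots. The roots [z j]
    need not be distinct. *)
Lemma annihilator (f g : {poly K}) (d : nat) (a : 'I_d -> K) :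
  (0 < d)%N -> size f = d.+1 ->
  exists P : {poly {poly K}}, [/\ P \is monic,
    forall k, (size (P`_k)%R <= annihilator_size d (size g))%N &
    forall t (z : 'I_d -> K), (forall j, f.[z j] = t) ->
      P.[\sum_j a j * g.[z j], t] = 0].
Proof.
move=> d0 sf.
have /fin_all_exists[G GP] : forall i : 'I_d, exists G : 'I_d -> {poly K},
    (forall k, (size (G k) <= size g + d)%N) /\
    g * 'X^i = \sum_k (G k \Po f) * 'X^k.
  move=> i; have [G [sG gE]] := base_expansion (g * 'X^i) d0 sf.
  exists G; split => // k; apply: leq_trans (sG k) _.
  apply: leq_trans (size_polyMleq _ _) _; rewrite size_polyXn addnS /=.
  by rewrite leq_add2l ltnW.
pose E := {ffun 'I_d -> 'I_d}.
(* Multiplication by the value of [g] at the [j]-th root acts on the [j]-th exponent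
   only. *)
pose M (e e' : E) : {poly K} := \sum_j (a j)%:P *
  \prod_k (if k == j then G (e j) (e' k) else (e' k == e k)%:R).
have sM e e' : (size (M e e') <= size g + d)%N.
  apply: leq_trans (size_sum _ _ _) _; apply/bigmax_leqP => j _.
  rewrite mul_polyC; apply: leq_trans (size_scale_leq _ _) _.
  rewrite (bigD1 j) //= eqxx.
  have [b ->] : exists b : bool,
      \prod_(k | k != j) (if k == j then G (e j) (e' k) else (e' k == e k)%:R) =
      b%:R :> {poly K}.
    elim/big_rec: _ => [|k x kj [b ->]]; first by exists true.
    by rewrite (negPf kj); exists ((e' k == e k) && b); case: (_ == _); rewrite ?mul1r ?mul0r.
  by case: b; rewrite ?mulr1 ?mulr0 ?size_poly0 //; case: (GP (e j)).
pose N := #|{: E}|.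
(* Eigenvectors are row vectors, hence the transposition. *)
pose A : 'M[{poly K}]_N := \matrix_(i', i) M (enum_val i) (enum_val i').
exists (char_poly A); split; first exact: char_poly_monic.
- move=> k; apply: leq_trans (max_size_coefXY _ _) _.
  rewrite sizeYE /char_poly -det_map_mx; apply: size_det_leq => i j.
  rewrite !mxE -sizeYE; apply/bigmax_leqP => c _.
  rewrite coefB coefC coefMn coefX.
  apply: leq_trans (size_polyD _ _) _; rewrite geq_max size_polyN.
  apply/andP; split.
    by case: (_ == _) => /=; case: (_ == _); rewrite ?mulr0n ?mulr1n ?size_poly0 ?size_poly1 //; lia.
  by case: (_ == _); [exact: sM|rewrite size_poly0].
move=> t z fz; set F := \sum_j _.
rewrite -horner2_swapXY horner_swapXY.
have -> : map_poly (horner_eval t) (char_poly A) =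
    char_poly (map_mx (horner_eval t) A) by exact: map_char_poly.
apply/eqP; rewrite -[_ == 0]/(root _ _) -eigenvalue_root_char.
pose w (e : E) := \prod_k z k ^+ e k.
apply/eigenvalueP; exists (\row_i w (enum_val i)); last first.
  apply/eqP => /rowP /(_ (enum_rank [ffun _ => Ordinal d0])); rewrite !mxE enum_rankK.
  rewrite /w big1 => [/eqP|k _]; first by rewrite oner_eq0.
  by rewrite ffunE expr0.
apply/rowP => i; rewrite !mxE; set e := enum_val i.
transitivity (\sum_(e' : E) w e' * (M e e').[t]).
  rewrite [RHS](reindex _ (onW_bij _ (enum_val_bij E))) /=.
  by apply: eq_bigr => i' _; rewrite !mxE.
under eq_bigr => e' _ do rewrite horner_sum mulr_sumr.
rewrite exchange_big /= /F mulr_suml; apply: eq_bigr => j _.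
pose Fm k (i : 'I_d) := z k ^+ i * (if k == j then (G (e j) i).[t] else (i == e k)%:R).
have term (e' : E) : w e' * ((a j)%:P *
   \prod_k (if k == j then G (e j) (e' k) else (e' k == e k)%:R)).[t] =
   a j * \prod_k Fm k (e' k).
  rewrite hornerM hornerC mulrCA big_split horner_prod; congr (_ * (_ * _)).
  by apply: eq_bigr => k _; case: ifP => // _; case: (_ == _); rewrite ?hornerC.
under eq_bigr => e' _ do rewrite term.
rewrite -mulr_sumr -(bigA_distr_bigA Fm) /Fm /= -mulrA; congr (_ * _).
rewrite /w [in RHS](bigD1 j) //= [in LHS](bigD1 j) //= eqxx mulrA; congr (_ * _).
  have [_ /(congr1 (horner^~ (z j)))] := GP (e j).
  rewrite hornerM hornerXn horner_sum => ->; apply: eq_bigr => k _.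
  by rewrite hornerM hornerXn horner_comp fz mulrC.
apply: eq_bigr => k /negPf kj; rewrite kj (bigD1 (e k)) //= eqxx mulr1.
by rewrite big1 ?addr0 // => k' /negPf ->; rewrite mulr0.
Qed.
End Annihilator.

(** * Finiteness of the number of isolated zeros *)

Section UpperBound.
Variable R : realType.
Local Notation C := (Cplx R).

Lemma horner2_cvg (P : {poly {poly R[i]}}) (F : C -> C) (t : C) :
  {for t, continuous F} -> {for t, continuous (fun u : C => P.[F u, u] : C)}.
Proof.
move=> Fc; elim/poly_ind: P => [|P p ih].
  have -> : (fun u : C => (0 : {poly {poly R[i]}}).[F u, u] : C) = cst 0.
    by apply/funext => u; rewrite !horner0.
  exact: cst_continuous.
have -> : (fun u : C => (P * 'X + p%:P).[F u, u] : C) =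
    (fun u : C => P.[F u, u] * F u) + (fun u : C => p.[u]).
  by apply/funext => u; rewrite !(hornerD, hornerM, hornerX, hornerC) fctE.
have c1 := @continuousM R[i] C _ _ t ih Fc.
exact: (continuousD c1 (@horner_cvg R p t)).
Qed.

Lemma sum_cvg (I : Type) (r : seq I) (h : I -> C -> C) (t : C) :
  (forall i, {for t, continuous (h i)}) ->
  {for t, continuous (fun u : C => \sum_(i <- r) h i u : C)}.
Proof.
move=> hc; elim: r => [|i r ih].
  have -> : (fun u : C => \sum_(i <- [::]) h i u : C) = cst 0.
    by apply/funext => u; rewrite big_nil.
  exact: cst_continuous.
have -> : (fun u : C => \sum_(i <- i :: r) h i u : C) =
    h i + (fun u : C => \sum_(i <- r) h i u : C).
  by apply/funext => u; rewrite big_cons.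
exact: (continuousD (hc i) ih).
Qed.

Lemma integral_along_cvg (f : {poly R[i]}) (c : Defs.cycle f) g z (t : C) :
  (forall j, root_germ f t (z j)) -> {for t, continuous (integral_along c g z)}.
Proof.
move=> zg; apply: sum_cvg => j.
have c1 : {for t, continuous (fun u : C => g.[z j u] : C)}.
  by apply: continuous_comp; [exact: root_germ_cvg (zg j)|exact: horner_cvg].
exact: (@continuousM R[i] C (cst _) _ t (@cst_continuous _ _ _ t) c1).
Qed.

(** The polynomial whose roots are listed is the lowest nonzero coefficient of the
    annihilator: a branch with an isolated zero at [t] is nonzero around [t], so
    its powers can be cancelled, and the rest tends to this coefficient at [t]. *)
Lemma isolated_zeros_bound (f g : {poly R[i]}) (c : Defs.cycle f) :
  (1 < size f)%N -> exists s : seq C,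
    (size s <= annihilator_size (size f).-1 (size g))%N /\
    forall t, isolated_zeros c g t -> t \in s.
Proof.
move=> sf; have sfE : size f = (size f).-1.+1 by rewrite prednK // ltnW.
have d0 : (0 < (size f).-1)%N by rewrite -ltnS -sfE.
have [P [mP sP PF]] := annihilator g (fun j => (coef c j)%:~R) d0 sfE.
have exP : exists k, P`_k != 0.
  by exists (size P).-1; rewrite -lead_coefE lead_coef_eq0 monic_neq0.
pose k := ex_minn exP; have [Pk0 kmin] : P`_k != 0 /\ forall i, (i < k)%N -> P`_i = 0.
  rewrite /k; case: ex_minnP => i Pi imin; split => // i' ii'.
  by apply/eqP; apply: contraTT ii' => /imin; rewrite -leqNgt.
have [s sE] := closed_field_poly_normal P`_k.
exists s; split.
  apply: leq_trans (sP k); rewrite sE size_scale ?lead_coef_eq0 //.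
  by rewrite size_prod_XsubC.
move=> t [/set_mem tz [V nV VA]].
have [nct [F /integral_branchP[z cz FE] Ft]] := tz.
have [_ zg] := continues_end cz.
have [h [hn _]] := local_sections sf nct.
have zgn : \forall u \near t, ~ critical_values f u /\ forall j, root_germ f u (z j).
  by apply: nearS (nearI hn (near_all (fun j => root_germ_near (zg j)))) => u [[]].
have [r r0 rP] := continues_near zgn.
have Fn0 : \forall u \near t, u <> t -> F u != 0.
  apply: nearS (nearI zgn (nearI nV (near_dist_lt t r0))) => u [[ncu _] [Vu tu]] ut.
  apply/eqP => Fu; apply: ut.
  have : (V `&` integral_zeros c g) u.
    split => //; split => //; exists F => //; apply/integral_branchP.
    exists z => //; apply: (continues_trans cz (fun j => germ_eq_refl t (z j))).
    by apply: rP => //; rewrite subrr normr0.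
  by rewrite VA.
pose Q := drop_poly k P.
have QE : P = Q * 'X^k.
  rewrite -[LHS](poly_take_drop k) (_ : take_poly k P = 0) ?add0r //.
  by apply/polyP => i; rewrite coef_take_poly coef0; case: ltnP => // /kmin.
have Fc : {for t, continuous F} by rewrite FE; exact: integral_along_cvg.
have Q0 : \forall u \near t, u <> t -> Q.[F u, u] = 0.
  apply: nearS (nearI zgn Fn0) => u [[_ gu] Fu] /Fu {}Fu.
  have : P.[F u, u] = 0.
    by rewrite FE; apply: PF => j; exact: root_germ_root (gu j).
  rewrite QE hornerM hornerXn hornerM -polyC_exp hornerC => /eqP.
  by rewrite mulf_eq0 expf_eq0 (negPf Fu) andbF orbF => /eqP.
have QPk : Q.[F t, t] = (P`_k).[t].
  by rewrite Ft horner_coef0 coef_drop_poly add0n.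
have : root P`_k t; last by rewrite sE rootZ ?lead_coef_eq0 // root_prod_XsubC.
rewrite rootE -QPk; apply: contraT => Qt.
have Qn : \forall u \near t, Q.[F u, u] != 0.
  have Hc := @horner2_cvg Q F t Fc.
  have := near_horner_neq0 (p := 'X) Hc; rewrite hornerX => /(_ Qt).
  by apply: nearS => u; rewrite hornerX.
have /near_norm_ball[e e0 eP] := nearI Q0 Qn.
have te : `|t - (t + e / 2)| < e.
  rewrite opprD addrA subrr add0r normrN ger0_norm ?divr_ge0 ?ltW //.
  by rewrite ltr_pdivrMr // ltr_pMr // ltr1n.
have [q0 qn] := eP _ te; rewrite q0 ?eqxx // in qn.
move=> /eqP; rewrite -subr_eq0 addrAC subrr add0r mulf_eq0 invr_eq0 pnatr_eq0 orbF.
by rewrite gt_eqF.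
Qed.
End UpperBound.

(** * Maxima, dimensions and the growth of the ratios *)

Section Maxima.

Lemma bounded_max (S : set nat) (l0 B : nat) : S l0 ->
  (forall l, S l -> (l <= B)%N) -> exists k, S k /\ forall l, S l -> (l <= k)%N.
Proof.
move=> S0 SB.
have exS : exists k, `[< S k >] by exists l0; apply/asboolP.
have bS k : `[< S k >] -> (k <= B)%N by move/asboolP; exact: SB.
case: (ex_maxnP exS bS) => k /asboolP Sk kmax.
by exists k; split => // l /asboolP; exact: kmax.
Qed.

Lemma max_natP (S : set nat) (l0 B : nat) : S l0 ->
  (forall l, S l -> (l <= B)%N) -> S (max_nat S) /\ (l0 <= max_nat S)%N.
Proof.
move=> S0 SB; have [] := xgetPex 0%N (bounded_max S0 SB).
by move=> Sk kmax; split => //; exact: kmax.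
Qed.

(** The bound [B] on the family ensures that [max_card] is not the default value. *)
Lemma max_card_ge (R : realType) (S : set (set (Cplx R))) A B k : S A ->
  (`I_k #<= A)%card -> (forall A, S A -> (A #<= `I_B)%card) ->
  (k <= Defs.max_card S)%N.
Proof.
move=> SA kA SB.
have fin A' : S A' -> exists n, (A' #= `I_n)%card.
  by move=> /SB AB; apply/finite_setP; exact: card_le_finite AB (finite_II B).
have [n An] := fin A SA.
have nB n' : (exists2 A', S A' & (A' #= `I_n')%card) -> (n' <= B)%N.
  move=> [A' SA' An']; rewrite -card_le_II; apply: card_le_trans (SB _ SA').
  by move: An'; rewrite card_eq_le => /andP[].
have nS : exists2 A', S A' & (A' #= `I_n)%card by exists A.
have [m [mS mmax]] := @bounded_max
  (fun n' => exists2 A', S A' & (A' #= `I_n')%card) n B nS nB.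
pose P := [set k | (exists2 A, S A & (A #= `I_k)%card) /\
    forall A, S A -> (A #<= `I_k)%card].
have [_ top] : P (Defs.max_card S).
  apply: (@xgetPex _ 0%N P); exists m; split => // A' SA'.
  have [n' An'] := fin A' SA'.
  apply: (@card_le_trans _ _ _ `I_n'); first by move: An'; rewrite card_eq_le => /andP[].
  by rewrite card_le_II; apply: mmax; exists A'.
by rewrite -card_le_II; exact: card_le_trans kA (top A SA).
Qed.
End Maxima.

Section Dimension.
Variable R : realType.
Local Notation C := (Cplx R).
Variables (f : {poly R[i]}) (c : Defs.cycle f) (n : nat).
Local Notation V := (integral_space c n).

(** A family of [k] integrals whose germs at the base point are linearly
    independent. *)
Definition germ_free k (e : 'I_k -> C -> C) :=
  (forall i, V (e i)) /\
  forall a : 'I_k -> R[i],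
    germ_eq (base c) (fun u => \sum_i a i * e i u) (fun=> 0) -> forall i, a i = 0.

(** A linear relation between the integrands gives one between the integrals. *)
Lemma germ_free_leq k (e : 'I_k -> C -> C) : germ_free e -> (k <= n.+1)%N.
Proof.
move=> [/fin_all_exists2[g sg gE] free]; rewrite leqNgt; apply/negP => nk.
pose A : 'M[R[i]]_(k, n.+1) := \matrix_(i, j) (g i)`_j.
have : kermx A != 0.
  rewrite kermx_eq0 /row_free; apply/negP => /eqP rA.
  by have := rank_leq_col A; rewrite rA leqNgt nk.
move=> /rowV0Pn[v /sub_kermxP vA /rV0Pn[i vi]].
case/eqP: vi; apply: (free (fun i => v 0 i)).
have g0 : \sum_i v 0 i *: g i = 0.
  apply/polyP => j; rewrite coef_sum coef0.
  have [jn|jn] := ltnP j n.+1; last first.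
    rewrite big1 // => i' _; rewrite coefZ nth_default ?mulr0 //.
    exact: leq_trans (sg i') jn.
  have /rowP/(_ (Ordinal jn)) := vA; rewrite !mxE => vAj; rewrite -[RHS]vAj.
  by apply: eq_bigr => i' _; rewrite coefZ !mxE.
rewrite /germ_eq; near=> u.
transitivity (abelian_integral c (\sum_i v 0 i *: g i) u); last first.
  by rewrite g0 /abelian_integral /integral_along big1 // => j _; rewrite horner0 mulr0.
rewrite /abelian_integral /integral_along.
under [RHS]eq_bigr => j _ do rewrite horner_sum mulr_sumr.
rewrite exchange_big; apply: eq_bigr => i' _ /=.
rewrite -gE /abelian_integral /integral_along mulr_sumr.
by apply: eq_bigr => j _; rewrite hornerZ mulrCA.
Unshelve. all: by end_near. Qed.

Lemma has_germ_dim_leq k : has_germ_dim (base c) V k -> (k <= n.+1)%N.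
Proof. by move=> [e [Ve fe _]]; apply: (@germ_free_leq k e). Qed.

(** A maximal free family of germs is a basis. *)
Lemma has_germ_dim_exists (g : {poly R[i]}) : (size g <= n.+1)%N ->
  ~ germ_eq (base c) (abelian_integral c g) (fun=> 0) ->
  exists2 k, (0 < k)%N & has_germ_dim (base c) V k.
Proof.
move=> sg g0.
have free1 : germ_free (fun _ : 'I_1 => abelian_integral c g).
  split=> [i|a h i]; first by exists g.
  apply: contrapT; rewrite (ord1 i) => /eqP ai; apply: g0; apply: nearS h => u.
  by rewrite big_ord1 => /eqP; rewrite mulf_eq0 (negPf ai) => /eqP.
have [k [[e [Ve fe]] kmax]] := @bounded_max
  (fun k => exists e : 'I_k -> C -> C, germ_free e) 1 n.+1
  (ex_intro _ _ free1) (fun k '(ex_intro e h) => germ_free_leq h).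
exists k; first by apply: kmax; exists (fun=> abelian_integral c g).
exists e; split => // F VF.
pose e' (i : 'I_k.+1) := if unlift ord0 i is Some j then e j else F.
have e'0 : e' ord0 = F by rewrite /e' unlift_none.
have e'S j : e' (lift ord0 j) = e j by rewrite /e' liftK.
have : ~ germ_free e'.
  move=> h; suff : (k.+1 <= k)%N by rewrite ltnn.
  by apply: kmax; exists e'.
move=> nfree; apply: contrapT => nF; apply: nfree; split.
  by move=> i; rewrite /e'; case: unlift.
move=> a ha.
have a0 : a ord0 = 0.
  apply: contrapT => /eqP a0; apply: nF; exists (fun i => - (a (lift ord0 i) / a ord0)).
  apply: nearS ha => u; rewrite big_ord_recl e'0 => /eqP; rewrite addr_eq0 => /eqP h.
  apply: (mulfI a0); rewrite h mulr_sumr -sumrN; apply: eq_bigr => i _.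
  by rewrite e'S mulNr mulrN mulrA mulrCA divff // mulr1.
have aS : forall i, a (lift ord0 i) = 0.
  apply: fe; apply: nearS ha => u; rewrite big_ord_recl a0 mul0r add0r => h.
  rewrite -[RHS]h.
  by apply: eq_bigr => i _; rewrite e'S.
by move=> i; case: (unliftP ord0 i) => [j ->|->].
Unshelve. all: by end_near. Qed.
End Dimension.

Section Main.
Variable R : realType.

(** A bound for the number of isolated zeros when both [f] and [g] have bounded
    degrees. *)
Definition zero_bound (m : nat) : nat :=
  \max_(p : 'I_m.+1 * 'I_m.+1) annihilator_size p.1 p.2.

Lemma isolated_zeros_card m (f g : {poly R[i]}) (c : Defs.cycle f) :
  (1 < (size f).-1 <= m)%N -> (size g <= m)%N ->
  (isolated_zeros c g #<= `I_(zero_bound m))%card.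
Proof.
move=> /andP[sf fm] gm.
have sf1 : (1 < size f)%N by case: (size f) sf => [|[]].
have [s [ss sP]] := isolated_zeros_bound g c sf1.
apply: (card_le_trans (card_le_seq sP)); rewrite card_le_II.
apply: leq_trans ss _; rewrite -ltnS in fm; rewrite -ltnS in gm.
exact: (@leq_bigmax _ (fun p : 'I_m.+1 * 'I_m.+1 => annihilator_size p.1 p.2)
  (Ordinal fm, Ordinal gm)).
Qed.

Section Fixed.
Variable l : nat.
Hypothesis hl : (1 < l./2)%N.
Let l2 : (1 < l)%N. Proof. by case: l hl => [|[|]]. Qed.

Lemma Z1_ge : ((l./2).-1 * l./2 <= Z1 R l.+2 l.+1)%N.
Proof.
have [c [cs cn cz]] := example_count R l2 hl.
apply: (max_card_ge (A := isolated_zeros c 'X^(l.+1)) (B := zero_bound l.+2)) cz _.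
  exists (trinomial R l), c, 'X^(l.+1); split => //.
    by rewrite size_trinomial //= leqnn.
  by rewrite size_polyXn.
move=> _ [f [c' [g [sf sg ->]]]]; exact: isolated_zeros_card.
Qed.

Lemma Z1S_ge : ((l./2).-1 * l./2 <= Z1S R l.+2 l.+1)%N.
Proof.
have [c [cs cn cz]] := example_count R l2 hl.
apply: (max_card_ge (A := isolated_zeros c 'X^(l.+1)) (B := zero_bound l.+2)) cz _.
  exists (trinomial R l), c, 'X^(l.+1); split => //.
    by rewrite size_trinomial.
  by rewrite size_polyXn.
move=> _ [f [c' [g [_ sf sg _ ->]]]]; apply: isolated_zeros_card.
  by rewrite sf /= leqnn.
by rewrite sg.
Qed.

Lemma dimP_bounds : (0 < dimP R l.+2 l.+1 <= l.+2)%N.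
Proof.
have [c [cs cn _]] := example_count R l2 hl.
have [k k0 kd] : exists2 k, (0 < k)%N & has_germ_dim (base c) (integral_space c l.+1) k.
  by apply: has_germ_dim_exists cn; rewrite size_polyX.
pose S := [set k | exists (f : {poly R[i]}) (c : Defs.cycle f),
    (1 < (size f).-1 <= l.+2)%N /\ has_germ_dim (base c) (integral_space c l.+1) k].
have Sk : S k.
  by exists (trinomial R l), c; split => //; rewrite size_trinomial //= leqnn.
have SB k' : S k' -> (k' <= l.+2)%N by move=> [f [c' [_ /has_germ_dim_leq]]].
have [Smax kmax] := max_natP Sk SB.
by rewrite (leq_trans k0 kmax) (SB _ Smax).
Qed.

Lemma dimPS_bounds : (0 < dimPS R l.+2 l.+1 <= l.+2)%N.
Proof.
have [c [cs cn _]] := example_count R l2 hl.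
have [k k0 kd] : exists2 k, (0 < k)%N & has_germ_dim (base c) (integral_space c l.+1) k.
  by apply: has_germ_dim_exists cn; rewrite size_polyX.
pose S := [set k | exists (f : {poly R[i]}) (c : Defs.cycle f),
    [/\ (1 < l.+2)%N, size f = l.+3, simple_cycle c
      & has_germ_dim (base c) (integral_space c l.+1) k]].
have Sk : S k by exists (trinomial R l), c; split => //; exact: size_trinomial.
have SB k' : S k' -> (k' <= l.+2)%N by move=> [f [c' [_ _ _ /has_germ_dim_leq]]].
have [Smax kmax] := max_natP Sk SB.
by rewrite (leq_trans k0 kmax) (SB _ Smax).
Qed.
End Fixed.

Lemma ratio_cvg (Z d : nat -> nat) :
  (forall l, (1 < l./2)%N ->
    ((l./2).-1 * l./2 <= Z l.+2)%N /\ (0 < d l.+2 <= l.+2)%N) ->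
  ((Z m)%:R / (d m)%:R : R) @[m --> \oo] --> +oo.
Proof.
move=> Zd.
have key A m : (16 <= m)%N -> 16 * A <= m%:R -> A <= (Z m)%:R / (d m)%:R :> R.
  case: m => [|[|l]] // m16 mA.
  have hl : (1 < l./2)%N by have := odd_double_half l; lia.
  have [Zl /andP[d0 dl]] := Zd l hl.
    (* With [q = l./2] one has [m <= 2 q + 3], and [16 (q - 1) q] dominates its
     square as soon as [3 <= q]. *)
have mm : (l.+2 * l.+2 <= 16 * Z l.+2)%N.
    apply: (@leq_trans (16 * ((l./2).-1 * l./2))); last by rewrite leq_mul2l.
    have := odd_double_half l; move: (l./2) hl => q hl; nia.
  have dp : 0 < (d l.+2)%:R :> R by rewrite ltr0n.
  rewrite ler_pdivlMr // -(@ler_pM2l _ 16) // mulrA.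
  apply: (@le_trans _ _ (l.+2%:R * (d l.+2)%:R)); first by rewrite ler_pM2r.
  rewrite -!natrM ler_nat; apply: leq_trans mm; by rewrite leq_mul2l dl orbT.
apply/cvgryPge => A; near=> m; apply: key; near: m.
  exact: nbhs_infty_ge.
exact: nbhs_infty_ger.
Unshelve. all: by end_near. Qed.
End Main.

Theorem theorem4 (R : realType) :
  ((Z1 R m m.-1)%:R / (dimP R m m.-1)%:R : R) @[m --> \oo] --> +oo
  /\
  ((Z1S R m m.-1)%:R / (dimPS R m m.-1)%:R : R) @[m --> \oo] --> +oo.
Proof.
split.
  apply: (@ratio_cvg R (fun m => Z1 R m m.-1) (fun m => dimP R m m.-1)) => l hl /=.
  by split; [exact: Z1_ge|exact: dimP_bounds].
apply: (@ratio_cvg R (fun m => Z1S R m m.-1) (fun m => dimPS R m m.-1)) => l hl /=.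
by split; [exact: Z1S_ge|exact: dimPS_bounds].
Qed.
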